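(* Let $(\mathcal{X},d)$ be a compact metric space of diameter $D>0$ and $T:\mathcal{X}\to\mathcal{X}$ a continuous map. Let $\mu$ be an ergodic $T$-invariant Borel probability measure on $\mathcal{X}$. Then for every real $L>1$ and every $\epsilon\in(0,2D)$, $$\widetilde{h}_\mu(4L\epsilon,T,1/L)\le R_\mu(\epsilon)\le\widetilde{h}_\mu\Big(\epsilon,T,\frac{\epsilon}{2D}\Big).$$
   Context: Average dynamical quantities: for $n\ge1$ let $\widetilde{d}_n(x,y)=\frac1n\sum_{k=0}^{n-1}d(T^kx,T^ky)$; an $(n,\epsilon)$-average dynamical ball is a ball of radius $\epsilon$ in the metric $\widetilde{d}_n$. For $\delta\in(0,1)$, $\widetilde{N}_\mu(n,\epsilon,\delta)$ is the minimum number of $(n,\epsilon)$-average dynamical balls needed to cover a set of $\mu$-measure strictly bigger than $1-\delta$, and $\widetilde{h}_\mu(\epsilon,T,\delta)=\limsup_{n\to\infty}\frac1n\log\widetilde{N}_\mu(n,\epsilon,\delta)$. Rate distortion function: for $n\ge 1$, $\epsilon>0$, a pair $(X,Y)$ satisfies condition $( * )_{n,\epsilon,\mu}$ if there is a probability space $(\Omega,\mathbb{P})$ such that $X:\Omega\to\mathcal{X}$ and $Y=(Y_0,\dots,Y_{n-1}):\Omega\to\mathcal{X}^n$ are measurable, $X_*\mathbb{P}=\mu$, and $\mathbb{E}\big(\frac1n\sum_{k=0}^{n-1}d(T^kX,Y_k)\big)\le\epsilon$. Then $$R_\mu(\epsilon)=\inf\frac1n I(X,Y),$$ the infimum being over all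 $n\ge1$ and all pairs $(X,Y)$ satisfying $( * )_{n,\epsilon,\mu}$. Here $I(X,Y)$ is the mutual information: for random variables $Z_1,Z_2$ with finite image, $I(Z_1,Z_2)=H(Z_1)+H(Z_2)-H(Z_1,Z_2)$ with $H$ the Shannon entropy, and in general $I(X,Y)$ is the supremum of $I(\alpha\circ X,\beta\circ Y)$ over measurable maps $\alpha,\beta$ with finite image. *)

(* Defs.v *)
From HB Require Import structures.
From mathcomp Require Export all_boot all_order all_algebra.
From mathcomp Require Export all_classical all_reals all_analysis.

Set Implicit Arguments.
Unset Strict Implicit.
Unset Printing Implicit Defensive.

Export Order.TTheory GRing.Theory Num.Theory.
Export numFieldNormedType.Exports.

Local Open Scope classical_set_scope.
Local Open Scope ring_scope.

(* No compatibility between the metric and the sigma-algebra is built in: that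
   the sigma-algebra is the Borel one has to be assumed separately. *)
#[short(type="measurableMetricType")]
HB.structure Definition MeasurableMetric d (K : numDomainType) :=
  {M of Metric K M & Measurable d M}.

Definition diameter (R : realType) (X : metricType R) : R :=
  sup [set r | exists x y : X, r = mdist x y].

Section dynamics.
Context d (X : measurableType d) (R : realType).
Implicit Types (T : X -> X) (mu : probability X R).

Definition invariant_measure T mu : Prop :=
  forall A, measurable A -> mu (T @^-1` A) = mu A.

Definition ergodic_measure T mu : Prop :=
  forall A, measurable A -> T @^-1` A = A -> mu A = 0%E \/ mu A = 1%E.

End dynamics.

Section information.
Context d (Omega : measurableType d) (R : realType) (P : probability Omega R).

(* Meant for Z with finite image; ln 0 = 0 gives the convention 0 log 0 = 0. *)
Definition shannon_entropy (S : choiceType) (Z : Omega -> S) : R :=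
  - \sum_(z \in range Z)
      (fine (P (Z @^-1` [set z])) * ln (fine (P (Z @^-1` [set z])))).

Definition finite_mutual_info (S1 S2 : choiceType)
    (Z1 : Omega -> S1) (Z2 : Omega -> S2) : R :=
  shannon_entropy Z1 + shannon_entropy Z2
    - shannon_entropy (fun w => (Z1 w, Z2 w)).

(* The values of a finite-image map only serve as labels, so they are taken in
   nat, whose sigma-algebra is discrete. *)
Definition mutual_info d1 d2 (S1 : measurableType d1) (S2 : measurableType d2)
    (X : Omega -> S1) (Y : Omega -> S2) : \bar R :=
  ereal_sup [set i | exists (a : {mfun S1 >-> nat}) (b : {mfun S2 >-> nat}),
    [/\ finite_set (range a), finite_set (range b) &
        i = (finite_mutual_info (a \o X) (b \o Y))%:E]].

End information.

Section average_dynamics.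
Context d (R : realType) (X : measurableMetricType d R).
Variables (T : X -> X) (mu : probability X R).

Definition avg_dist (n : nat) (x y : X) : R :=
  n%:R^-1 * \sum_(k < n) mdist (iter k T x) (iter k T y).

Definition avg_ball (n : nat) (eps : R) (x : X) : set X :=
  [set y | avg_dist n x y < eps].

(* The infimum of a set of natural numbers; it is +oo if there is no finite
   cover. *)
Definition avg_cover_number (n : nat) (eps delta : R) : \bar R :=
  ereal_inf [set N | exists2 s : seq X, N = (size s)%:R%:E &
    exists A, [/\ measurable A, ((1 - delta)%:E < mu A)%E &
      A `<=` \bigcup_(x in [set` s]) avg_ball n eps x]].

(* The junk term at n = 0 does not affect the limit superior. *)
Definition avg_entropy (eps delta : R) : \bar R :=
  limn_esup (fun n => (n%:R^-1)%:E * lne (avg_cover_number n eps delta))%E.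

Definition rate_condition (n : nat) (eps : R)
    d' (Omega : measurableType d') (P : probability Omega R)
    (x : {RV P >-> X}) (y : {RV P >-> n.-tuple X}) : Prop :=
  (forall A, measurable A -> distribution P x A = mu A) /\
  ('E_P[fun w => (n%:R^-1 *
     \sum_(k < n) mdist (iter k T (x w)) (tnth (y w) k))%R] <= eps%:E)%E.

Definition rate_distortion (eps : R) : \bar R :=
  ereal_inf [set r | exists (n : nat) (d' : measure_display)
      (Omega : measurableType d') (P : probability Omega R)
      (x : {RV P >-> X}) (y : {RV P >-> n.-tuple X}),
    [/\ (0 < n)%N, rate_condition eps x y &
        r = ((n%:R^-1)%:E * mutual_info P x y)%E]].

End average_dynamics.

(* Main.v *)
From HB Require Import structures.
Require Import Defs.
From mathcomp Require Import ring lra zify measurable_realfun.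

(** Both inequalities are halves of a source coding theorem, for the source that
    emits the points of a [mu]-random orbit.

    Ergodicity enters through one device, [ergodic_tiling]. If measurable sets
    [A n] have a limit superior of positive measure, then almost every orbit enters
    it; so, after a delay bounded by some [J], most points lie in an [A n] with [n]
    as large as desired compared with [J]. Cutting an orbit greedily at such visits
    tiles it by long blocks that start in the sets [A n], up to short delays and to
    a set of times whose expected proportion is small, by invariance alone. Applied
    to the sets where an average is too large, this gives a one-sided ergodic
    theorem in measure, [ergodic_average_le].

    Upper bound on the rate distortion function. Let the [A n] be the sets covered by
    about exp (c * n) average balls. An orbit is tiled by blocks that start in the
    [A n], and each block is described by the orbit of the centre of a ball; the
    numbers of words so obtained satisfy a recursion whose solution is at most
    exp (c' * m) for any c' > c ([tiling_code]). Since the blocks cover almost all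
    times, the measure of the [A n] only has to be positive, and the expected
    distortion is eps plus a small error; a short stretch of symbols described
    more accurately compensates for the error at a negligible rate
    ([rate_distortion_le_padded_code]). The description of a random point is then a
    variable whose information is at most the logarithm of the number of words.

    Lower bound. A coupling of length n is discretized by a partition into small
    cells, so that it becomes a finite joint law: an output law and a channel. Time
    is cut into superblocks; on each of them a random code word consists of a random
    offset and of letters drawn from the output law. Under the channel, the cost and
    the likelihood ratio of a code word are sums of independent bounded terms whose
    means are orbit sums, thanks to the random offset, and these are controlled by
    the ergodic theorem. A deviation bound and a change of measure show that a random
    code word describes a typical orbit with probability at least exp (- m * I / n),
    up to a small error in the exponent ([random_code_ball]). Choosing code words
    greedily turns this into a cover of most of the space by about exp (m * I / n)
    sets ([greedy_cover]), each contained in an average ball centred at any of its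
    points, of twice the radius ([orbit_dist_le]). This bounds the average entropy
    at every radius larger than 2 * eps, in particular at 4 * L * eps. *)

Set Implicit Arguments.
Unset Strict Implicit.
Unset Printing Implicit Defensive.

Local Open Scope classical_set_scope.
Local Open Scope ring_scope.

(** * Tiling the orbits of an ergodic map *)

Lemma nat_ge (R : realType) (x : R) : exists N : nat, forall n, (N <= n)%N -> x <= n%:R.
Proof.
exists (Num.truncn x).+1 => n; rewrite -(ler_nat R); apply: le_trans.
by rewrite ltW// truncnS_gt.
Qed.

(** [A n] stands for the points from which the next [n] steps form a well-behaved
    block. At a point of [tile_set] the orbit can be cut: after a delay shorter
    than [J] such a block begins, and its length lies between [N0] and [N1]. *)
Definition tile_set (X : Type) (T : X -> X) (A : (set X)^nat) J N0 N1 : set X :=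
  [set x | exists j n, [/\ (j < J)%N, (N0 <= n < N1)%N & A n (iter j T x)]].

Section ergodic_tiling.
Context d (X : measurableType d) (R : realType) (T : X -> X)
  (mu : probability X R).
Context (mT : measurable_fun setT T) (mu_inv : invariant_measure T mu).

Lemma measurable_iter n : measurable_fun setT (iter n T).
Proof. by elim: n => [|n IH]; [exact: measurable_id|exact: measurableT_comp]. Qed.

Lemma measurable_preimage_iter n A : measurable A -> measurable (iter n T @^-1` A).
Proof. by move=> mA; rewrite -[X in measurable X]setTI; exact: measurable_iter. Qed.

Lemma measure_preimage_iter n A : measurable A -> mu (iter n T @^-1` A) = mu A.
Proof.
elim: n => // n IH mA.
rewrite -(IH mA) -(mu_inv (measurable_preimage_iter n mA)).
by congr (mu _); apply/funext => x; rewrite /preimage/= -iterS iterSr.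
Qed.

Lemma increasing_measure_gt (F : (set X)^nat) (c : \bar R) :
  (forall n, measurable (F n)) -> nondecreasing_seq F ->
  (c < mu (\bigcup_n F n))%E -> exists n, (c < mu (F n))%E.
Proof.
move=> mF nF clt; apply: contrapT => /forallNP H.
have := nondecreasing_cvg_mu (mu := mu) mF (bigcup_measurable (fun i _ => mF i)) nF.
move=> cv; have : (mu (\bigcup_n F n) <= c)%E.
  rewrite -(cvg_lim _ cv)//; apply: lime_le; first by apply/cvg_ex; eexists; exact: cv.
  by apply: nearW => n /=; rewrite leNgt; apply/negP/H.
by rewrite leNgt clt.
Qed.

Lemma measure_setC_le H (eta : R) : measurable H -> ((1 - eta)%:E < mu H)%E ->
  (mu (~` H) <= eta%:E)%E.
Proof.
move=> mH; rewrite probability_setC//.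
rewrite -(fineK (fin_num_measure mu _ mH)) -EFinB lte_fin lee_fin; lra.
Qed.

(** The set swept out by the preimages of [F] contains its own preimage, hence
    has the same measure as the intersection of its iterated preimages, which is
    exactly invariant; ergodicity leaves only the value 1. *)
Lemma ergodic_sweep F : ergodic_measure T mu -> measurable F -> (0 < mu F)%E ->
  mu (\bigcup_j (iter j T @^-1` F)) = 1%E.
Proof.
move=> mu_erg mF F0; set E := \bigcup_j _.
have mE : measurable E.
  by apply: bigcup_measurable => j _; exact: measurable_preimage_iter.
pose G k := iter k T @^-1` E.
have mG k : measurable (G k) by exact: measurable_preimage_iter.
have GS k : G k.+1 `<=` G k.
  by move=> x [j _ Fj]; exists j.+1 => //; rewrite /preimage/= -iterS iterSr.
have nG : nonincreasing_seq G by apply/nonincreasing_seqP => k; apply/subsetPset/GS.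
have mI : measurable (\bigcap_k G k) by exact: bigcap_measurable.
have muI : mu (\bigcap_k G k) = mu E.
  have cv := nonincreasing_cvg_mu (mu := mu)
    (le_lt_trans (probability_le1 mu (mG 0%N)) (ltry _)) mG mI nG.
  rewrite -(cvg_lim _ cv)//; apply: lim_near_cst => //.
  by apply: nearW => k /=; exact: measure_preimage_iter.
have invI : T @^-1` (\bigcap_k G k) = \bigcap_k G k.
  apply/seteqP; split => x Gx k _.
    by apply: GS; rewrite /G/preimage/= -iterS iterSr; exact: Gx.
  by have := Gx k.+1 I; rewrite /G/preimage/= -iterS iterSr.
have FE : (mu F <= mu E)%E by apply: le_measure; rewrite ?inE//; exact: (@bigcup_sup _ _ 0%N).
have := mu_erg _ mI invI; rewrite muI; case => // E0.
by move: (lt_le_trans F0 FE); rewrite E0 ltxx.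
Qed.

Lemma measurable_tile_set (A : (set X)^nat) J N0 N1 : (forall n, measurable (A n)) ->
  measurable (tile_set T A J N0 N1).
Proof.
move=> mA; have -> : tile_set T A J N0 N1 =
    \bigcup_(j in `I_J) \bigcup_(n in [set n | (N0 <= n < N1)%N]) iter j T @^-1` A n.
  apply/seteqP; split => x.
    by move=> [j [n [jJ nN Ax]]]; exists j => //; exists n.
  by move=> [j jJ [n nN Ax]]; exists j, n.
apply: bigcup_measurable => j _; apply: bigcup_measurable => n _.
exact: measurable_preimage_iter.
Qed.

(** Almost every orbit enters [lim_sup_set A], so a delay [J] suffices for most
    points; once there, it lies in [A n] for infinitely many [n], so that the
    lower bound [N0] on the length is free. What matters is the order of the
    quantifiers: [N0] may be taken huge compared with [J], which makes the delays
    a negligible fraction of the time. *)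
Lemma ergodic_tiling (A : (set X)^nat) : ergodic_measure T mu -> (forall n, measurable (A n)) ->
  (0 < mu (lim_sup_set A))%E -> forall eta : R, 0 < eta ->
  exists J, forall N0, exists N1, ((1 - eta)%:E < mu (tile_set T A J N0 N1))%E.
Proof.
move=> mu_erg mA A0 eta eta0.
have mF : measurable (lim_sup_set A).
  by apply: bigcap_measurable => // n _; apply: bigcup_measurable => k _.
pose V J := \bigcup_(j in `I_J) (iter j T @^-1` lim_sup_set A).
have mV J : measurable (V J).
  by apply: bigcup_measurable => j _; exact: measurable_preimage_iter.
have [||J muJ] := @increasing_measure_gt V (1 - eta)%:E mV.
  by move=> m n mn; apply/subsetPset => x [j jm Fj]; exists j => //; exact: leq_trans mn.
  have -> : \bigcup_J V J = \bigcup_j (iter j T @^-1` lim_sup_set A).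
    apply/seteqP; split => x [j jm]; first by case=> i _ ?; exists i.
    by move=> ?; exists j.+1 => //; exists j => /=.
  by rewrite ergodic_sweep// lte_fin ltrBlDr ltrDl.
exists J => N0.
have [|||N1 H] := @increasing_measure_gt (tile_set T A J N0) (1 - eta)%:E; last by exists N1.
- by move=> n; exact: measurable_tile_set.
- move=> m n mn; apply/subsetPset => x [j [k [jJ /andP[k0 km] Ax]]].
  by exists j, k; split => //; rewrite k0/= (leq_trans km).
- apply: lt_le_trans muJ _; apply: le_measure; rewrite ?inE//.
    by apply: bigcup_measurable => n _; exact: measurable_tile_set.
  move=> x [j jJ /(_ N0 I)[k /= N0k Ak]]; exists k.+1 => //; exists j, k.
  by split => //; rewrite N0k/=.
Qed.

End ergodic_tiling.

(** * Orbit sums and a one-sided ergodic theorem *)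

Definition orbit_sum X (R : realType) (T : X -> X) (f : X -> R) m x : R :=
  \sum_(i < m) f (iter i T x).

Lemma orbit_sumD X (R : realType) (T : X -> X) (f : X -> R) m n x :
  orbit_sum T f (m + n) x = orbit_sum T f m x + orbit_sum T f n (iter m T x).
Proof.
rewrite /orbit_sum big_split_ord/=; congr (_ + _).
by apply: eq_bigr => i _; rewrite addnC iterD.
Qed.

Lemma orbit_sumS X (R : realType) (T : X -> X) (f : X -> R) m x :
  orbit_sum T f m.+1 x = f x + orbit_sum T f m (T x).
Proof. by rewrite -add1n orbit_sumD {1}/orbit_sum big_ord1. Qed.

Lemma orbit_sum_ge0 X (R : realType) (T : X -> X) (f : X -> R) m x :
  (forall x, 0 <= f x) -> 0 <= orbit_sum T f m x.
Proof. by move=> f0; apply: sumr_ge0. Qed.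

Section birkhoff.
Context d (X : measurableType d) (R : realType) (T : X -> X)
  (mu : probability X R).
Context (mT : measurable_fun setT T) (mu_inv : invariant_measure T mu)
  (mu_erg : ergodic_measure T mu).

(** A lower bound on infinitely many of the measures already bounds the
    measure of the limit superior: each tail union is at least that large. *)
Lemma lim_sup_set_measure_ge (A : (set X)^nat) (c : \bar R) :
  (forall n, measurable (A n)) ->
  (forall N, exists2 n, (N <= n)%N & (c <= mu (A n))%E) ->
  (c <= mu (lim_sup_set A))%E.
Proof.
move=> mA H.
have mU n : measurable (\bigcup_(k in [set k | (n <= k)%N]) A k).
  by apply: bigcup_measurable => k _.
have cv := lim_sup_set_cvg mu A mA (le_lt_trans (probability_le1 mu (mU 0%N)) (ltry _)).
rewrite -(cvg_lim _ cv)//; apply: lime_ge; first by apply/cvg_ex; eexists; exact: cv.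
apply: nearW => n; have [k nk ck] := H n; apply: (le_trans ck).
by apply: le_measure; rewrite ?inE//; exact: bigcup_sup.
Qed.

Lemma measurable_orbit_sum f m : measurable_fun setT f ->
  measurable_fun setT (orbit_sum T f m : X -> R).
Proof.
move=> mf; apply: measurable_sum => i.
by apply: measurableT_comp => //; exact: measurable_iter.
Qed.

Lemma integral_iter (f : X -> R) i : measurable_fun setT f -> (forall x, 0 <= f x) ->
  (\int[mu]_x (f (iter i T x))%:E = \int[mu]_x (f x)%:E)%E.
Proof.
move=> mf f0.
have mTi := measurable_iter mT i.
rewrite -(ge0_integral_pushforward mTi mu measurableT (f := EFin \o f))//=.
- apply: eq_measure_integral => A mA _ /=; rewrite /pushforward.
  exact: measure_preimage_iter.
- exact/measurable_EFinP.
- by move=> x _; rewrite lee_fin.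
Qed.

Lemma integral_orbit_sum (f : X -> R) m : measurable_fun setT f ->
  (forall x, 0 <= f x) ->
  (\int[mu]_x (orbit_sum T f m x)%:E = m%:R%:E * \int[mu]_x (f x)%:E)%E.
Proof.
move=> mf f0; under eq_integral do rewrite /orbit_sum -sumEFin.
rewrite ge0_integral_sum//=; last 2 first.
- move=> i; apply/measurable_EFinP; apply: measurableT_comp => //.
  exact: measurable_iter.
- by move=> i x _; rewrite lee_fin.
under eq_bigr do rewrite integral_iter//.
by rewrite sumr_const card_ord mule_natl.
Qed.

(** Induction on the length. From a point of [H], a block of length [j + n]
    contributes more than [n * b], and its delay [j < J] costs at most the fraction
    [eta] of [n]. From a point outside [H] one advances by a single step, which the
    indicator pays for. What remains at the end is shorter than [N1 + J]. *)
Lemma tile_orbit_sum_ge (f : X -> R) (b eta : R) J N0 N1 m x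
  (H := tile_set T (fun n => [set x | n%:R * b < orbit_sum T f n x]) J N0 N1) :
  (forall x, 0 <= f x) -> 0 <= b -> (0 < N0)%N -> J%:R <= eta * N0%:R -> 0 < eta ->
  b * (m%:R * (1 - eta) - (N1 + J)%:R) <=
    orbit_sum T f m x + b * orbit_sum T \1_(~` H) m x.
Proof.
move=> f0 b0 N00 JN eta0.
have i0 m' x' : 0 <= orbit_sum T (\1_(~` H) : X -> R) m' x'.
  by apply: orbit_sum_ge0 => y; rewrite indicE.
elim/ltn_ind: m x => m IH x.
have [mN|Nm] := ltnP m (N1 + J).
  apply: (@le_trans _ _ 0); last by rewrite addr_ge0 ?mulr_ge0 ?orbit_sum_ge0.
  rewrite mulr_ge0_le0//.
  have : (m%:R : R) <= (N1 + J)%:R by rewrite ler_nat ltnW.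
  have : 0 <= (m%:R : R) * eta by rewrite mulr_ge0// ltW.
  lra.
have [Hx|Hx] := pselect (H x).
  have [j [n [jJ /andP[N0n nN1] /= An]]] := Hx.
  have jnm : (j + n <= m)%N by rewrite (leq_trans _ Nm)// addnC leq_add// ltnW.
  have jn0 : (m - (j + n) < m)%N by lia.
  have := IH _ jn0 (iter (j + n) T x).
  rewrite -(subnKC jnm) !orbit_sumD -addrA natrD.
  have := i0 (j + n)%N x; rewrite orbit_sumD => i0'.
  have := orbit_sum_ge0 T j x f0.
  have jJR : (j%:R : R) <= J%:R by rewrite ler_nat ltnW.
  have N0nR : (N0%:R : R) <= n%:R by rewrite ler_nat.
  rewrite addKn natrD.
  set w := (m - (j + n))%:R.
  set o1 := orbit_sum T f j x.
  set o2 := orbit_sum T f n _ in An *.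
  have : 0 <= (j%:R : R) by [].
  move: i0'; set i1 := orbit_sum T \1_(~` H) j _ + _ => i0' ? ? ?.
  have key : (j%:R + n%:R) * (1 - eta) <= (n%:R : R).
    by have : eta * N0%:R <= eta * n%:R by [rewrite ler_pM2l]; nra.
  have : b * ((j%:R + n%:R) * (1 - eta)) <= b * n%:R by rewrite ler_wpM2l.
  by have : 0 <= b * i1 by [exact: mulr_ge0]; lra.
case: m => [|m] in IH Nm *.
  by rewrite /orbit_sum !big_ord0 mulr0 addr0 mulr0n mul0r sub0r mulr_ge0_le0//.
rewrite !orbit_sumS indicE.
have := IH m (ltnSn m) (T x).
rewrite -natr1.
have -> : x \in ~` H by rewrite in_setC; apply/negP; rewrite inE.
have : 0 <= b * eta by rewrite mulr_ge0// ltW.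
have := f0 x; rewrite /=.
set o1 := orbit_sum T f m _; set o2 := orbit_sum T _ m _; set c := (N1 + J)%:R.
nra.
Qed.

(** The one-sided ergodic theorem in measure, by the argument of Katznelson and
    Weiss. Otherwise the sets where the average exceeds [b] have a limit superior
    of positive measure; tiling orbits by blocks with large averages and
    integrating then gives [b <= \int f] up to an arbitrarily small error. *)
Lemma ergodic_average_le (f : X -> R) (b kappa : R) : measurable_fun setT f ->
  (forall x, 0 <= f x) -> (\int[mu]_x (f x)%:E < b%:E)%E -> 0 < kappa ->
  exists m0, forall m, (m0 <= m)%N ->
    (mu [set x | (m%:R * b < orbit_sum T f m x)%R] < kappa%:E)%E.
Proof.
move=> mf f0 fb kappa0.
set A := fun n => [set x | (n%:R * b < orbit_sum T f n x)%R].
have mA n : measurable (A n).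
  have := measurable_orbit_sum n mf => /(_ measurableT _ (measurable_itv `]n%:R * b, +oo[)).
  rewrite setTI; congr measurable; apply/seteqP; split => x /=; by rewrite in_itv/= andbT.
have if0 : (0 <= \int[mu]_x (f x)%:E)%E by apply: integral_ge0 => x _; rewrite lee_fin.
have [c cE] : exists c : R, (\int[mu]_x (f x)%:E = c%:E)%E.
  exists (fine (\int[mu]_x (f x)%:E)%E); rewrite fineK// ge0_fin_numE//.
  by rewrite (lt_trans fb) ?ltry.
rewrite cE lte_fin in fb; rewrite cE lee_fin in if0.
apply: contrapT => /forallNP H.
have {}H N : exists2 n, (N <= n)%N & (kappa%:E <= mu (A n))%E.
  move: (H N) => /existsNP[n /not_implyP[Nn /negP]]; rewrite -leNgt => ?.
  by exists n.
have A0 : (0 < mu (lim_sup_set A))%E.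
  by apply: (@lt_le_trans _ _ kappa%:E); [rewrite lte_fin|exact: lim_sup_set_measure_ge].
have b0 : 0 < b by exact: le_lt_trans fb.
pose eta := (b - c) / (4 * b).
have eta0 : 0 < eta by rewrite divr_gt0 ?subr_gt0 ?mulr_gt0.
have [J HJ] := ergodic_tiling mT mu_inv mu_erg mA A0 eta0.
pose N0 := (Num.truncn (J%:R / eta)).+1.
have JN : J%:R <= eta * N0%:R.
  by rewrite mulrC -ler_pdivrMr// ltW// truncnS_gt.
have [N1] := HJ N0; set H' := tile_set _ _ _ _ _ => muH.
have mH' : measurable H' by exact: measurable_tile_set.
have muCH : (mu (~` H') <= eta%:E)%E by exact: measure_setC_le.
have main m : b * (m%:R * (1 - eta) - (N1 + J)%:R) <= m%:R * c + b * (m%:R * eta).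
  have [lt0|ge0] := ltP (b * (m%:R * (1 - eta) - (N1 + J)%:R)) 0.
    apply: (le_trans (ltW lt0)).
    by rewrite addr_ge0// mulr_ge0 ?(ltW b0)// mulr_ge0// ltW.
  have mi : measurable_fun setT (\1_(~` H') : X -> R).
    by apply: measurable_indic; exact: measurableC.
  have i0 x : 0 <= (\1_(~` H') : X -> R) x by rewrite indicE.
  rewrite -lee_fin.
  apply: (@le_trans _ _ (\int[mu]_x (orbit_sum T f m x + b * orbit_sum T \1_(~` H') m x)%:E)%E).
    rewrite -[leLHS]mule1 -(@probability_setT _ _ _ mu) -integral_cst//.
    apply: ge0_le_integral => //.
    - apply/measurable_EFinP/measurable_funD; first exact: measurable_orbit_sum.
      by apply: measurable_funM => //; exact: measurable_orbit_sum.
    - by move=> x _; rewrite lee_fin tile_orbit_sum_ge// ltW.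
  under eq_integral do rewrite EFinD EFinM.
  rewrite ge0_integralD//=; last 4 first.
  - by move=> x _; rewrite lee_fin orbit_sum_ge0.
  - by apply/measurable_EFinP; exact: measurable_orbit_sum.
  - by move=> x _; rewrite -EFinM lee_fin mulr_ge0 ?orbit_sum_ge0// ltW.
  - apply/measurable_EFinP; apply: measurable_funM => //.
    exact: measurable_orbit_sum.
  rewrite integral_orbit_sum// cE ge0_integralZl_EFin//=; last 3 first.
  - by move=> x _; rewrite lee_fin orbit_sum_ge0.
  - by apply/measurable_EFinP; exact: measurable_orbit_sum.
  - exact: ltW.
  rewrite integral_orbit_sum// integral_indic ?setIT//; last exact: measurableC.
  rewrite EFinD !EFinM leeD2l// lee_pmul2l ?lte_fin//.
  by rewrite lee_wpmul2l// lee_fin.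
pose k : R := (N1 + J)%:R.
pose m := (Num.truncn (2 * b * k / (b - c))).+1.
have bc : 0 < b - c by rewrite subr_gt0.
have : 2 * b * k < m%:R * (b - c) by rewrite -ltr_pdivrMr// truncnS_gt.
have := main m; rewrite -/k.
have : b * eta = (b - c) / 4 by rewrite /eta; field; rewrite gt_eqF.
set M : R := m%:R => e1.
have -> : b * (M * (1 - eta) - k) = M * b - M * (b * eta) - b * k by ring.
have -> : b * (M * eta) = M * (b * eta) by ring.
rewrite e1; lra.
Qed.

End birkhoff.

(** * Finite-valued measurable maps and compact metric spaces *)

Section labels.
Context d (S : measurableType d).

(** Measurability of a map towards a type without a sigma-algebra: labels are
    finite or countable data, for which every set of values is an event. *)
Definition measurable_label (I : Type) (L : S -> I) :=
  forall B : set I, measurable (L @^-1` B).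

Lemma measurable_label_fiber (I : countType) (L : S -> I) :
  (forall i, measurable (L @^-1` [set i])) -> measurable_label L.
Proof.
move=> mL B.
have -> : L @^-1` B = \bigcup_(n in [set n | exists2 i, B i & n = pickle i])
    (if unpickle n is Some i then L @^-1` [set i] else set0).
  apply/seteqP; split => x.
    by move=> Bx; exists (pickle (L x)); [exists (L x)|rewrite pickleK].
  by move=> [n [i Bi ->]]; rewrite pickleK => /= ->.
by apply: bigcup_measurable => n _; case: (unpickle n).
Qed.

Lemma measurable_label_ffun (N : finType) (I : countType) (L : N -> S -> I) :
  (forall n, measurable_label (L n)) ->
  measurable_label (fun x => [ffun n => L n x]).
Proof.
move=> mL; apply: measurable_label_fiber => h.
have -> : (fun x => [ffun n => L n x]) @^-1` [set h] =
    \big[setI/setT]_(n : N) (L n @^-1` [set h n]).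
  apply/seteqP; split => x; rewrite -bigcap_seq.
    by move=> <- n _; rewrite /preimage/= ffunE.
  by move=> H; apply/ffunP => n; rewrite ffunE; apply: H; rewrite /= mem_index_enum.
by apply: bigsetI_measurable => n _; exact: mL.
Qed.

Lemma measurable_fun_label d' (S' : measurableType d') (I : Type) (L : S -> I) (g : I -> S') :
  measurable_label L -> measurable_fun setT (g \o L).
Proof. by move=> mL _ B mB; rewrite setTI comp_preimage; exact: mL. Qed.

Lemma measurable_fun_piecewise d' (S' : measurableType d') (I : finType) (L : S -> I)
  (F : I -> S -> S') : measurable_label L -> (forall i, measurable_fun setT (F i)) ->
  measurable_fun setT (fun x => F (L x) x).
Proof.
move=> mL mF _ B mB; rewrite setTI.
rewrite (_ : _ @^-1` B = \big[setU/set0]_(i : I) (L @^-1` [set i] `&` F i @^-1` B)).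
  apply: bigsetU_measurable => i _; apply: measurableI; first exact: mL.
  by rewrite -[X in measurable X]setTI; exact: mF.
apply/seteqP; split => x; rewrite -bigcup_seq.
  by move=> Bx; exists (L x) => //=; rewrite mem_index_enum.
by move=> [i _ [/= <-]].
Qed.

(** A measurable selection: the choice is made by [pick], as a function of the
    finite table of the truth values [P n x]. *)
Lemma measurable_select (N : finType) (P : N -> S -> bool) :
  (forall n, measurable_fun setT (P n)) -> (forall x, exists n, P n x) ->
  exists g : S -> N, measurable_label g /\ forall x, P (g x) x.
Proof.
move=> mP exP; pose h x := [ffun n => P n x].
have mh : measurable_label h.
  apply: measurable_label_ffun => n; apply: measurable_label_fiber => b.
  by rewrite -[X in measurable X]setTI; exact: mP.
have /choice[g gE] x : exists n, [pick n | h x n] = Some n.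
  have [n Pn] := exP x.
  by case: pickP => [k _|/(_ n)]; [exists k|rewrite ffunE Pn].
exists g; split; last first.
  by move=> x; move: (gE x); case: pickP => // n; rewrite ffunE => ? [<-].
move=> B; rewrite [X in measurable X](_ : _ =
    h @^-1` [set b | exists2 n, B n & [pick n | b n] = Some n]); first exact: mh.
apply/seteqP; split => x /=; first by exists (g x).
by move=> [n Bn]; rewrite gE => -[->].
Qed.

End labels.

Lemma measurable_label_precomp d d' (S : measurableType d) (S' : measurableType d')
  (I : Type) (f : S' -> S) (L : S -> I) :
  measurable_fun setT f -> measurable_label L -> measurable_label (L \o f).
Proof.
move=> mf mL B; rewrite comp_preimage -[X in measurable X]setTI.
exact: mf.
Qed.

Section compact_borel.
Context d (R : realType) (X : measurableMetricType d R).
Context (X_borel : @measurable d X = <<s @open X >>)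
    (X_compact : compact [set: X]).

Lemma open_borel (U : set X) : open U -> measurable U.
Proof. by move=> oU; rewrite X_borel; exact: sub_gen_smallest. Qed.

Lemma continuous_borel (T : X -> X) : continuous T -> measurable_fun setT T.
Proof.
move=> cT; apply: (@measurability _ _ _ _ _ _ (@open X)); first exact: X_borel.
move=> _ [U oU <-]; rewrite setTI; apply: open_borel.
by move/continuousP : cT; apply.
Qed.

Lemma mdist_diff (x y c : X) : `|mdist c x - mdist c y| <= mdist x y.
Proof.
rewrite ler_norml; have := metric_triangle c x y; have := metric_triangle c y x.
rewrite (metric_sym y x); move=> *; apply/andP; split; lra.
Qed.

Lemma measurable_mdist (c : X) : measurable_fun setT (fun x => mdist x c).
Proof.
apply: (measurability (@RGenOInfty.G R)) => //; first exact: RGenOInfty.measurableE.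
move=> _ [_ [r ->] <-]; rewrite setTI; apply: open_borel.
rewrite openE => x /=; rewrite in_itv/= andbT => rx.
apply/nbhs_ballP; exists (mdist x c - r) => /=; first by rewrite subr_gt0.
move=> y; rewrite ballEmdist/= => xy; rewrite in_itv/= andbT.
have := metric_triangle x y c; lra.
Qed.

Lemma compact_net (e : R) : 0 < e ->
  exists s : seq X, forall x, exists2 c, c \in s & mdist x c < e.
Proof.
move=> e0; have := X_compact.
rewrite compact_cover => /(_ X setT (fun c => [set x | mdist c x < e])).
case.
- move=> c _; rewrite openE => x /= cx.
  apply/nbhs_ballP; exists (e - mdist c x) => /=; first by rewrite subr_gt0.
  by move=> y; rewrite ballEmdist/= => xy; have := metric_triangle c x y; lra.
- by move=> x _; exists x => //=; rewrite mdistxx.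
- move=> D' _ H; exists (finmap.enum_fset D') => x; have [c Dc /= cx] := H x I.
  by exists c => //; rewrite metric_sym.
Qed.

Lemma mdist_le_diameter (x y : X) : mdist x y <= diameter X.
Proof.
apply: sup_upper_bound; last by exists x, y.
split; first by exists (mdist x x), x, x.
have [s Hs] := compact_net ltr01.
exists (2 + \sum_(c <- s) \sum_(c' <- s) mdist c c') => _ [a [b ->]].
have [c cs ac] := Hs a; have [c' cs' bc] := Hs b.
have : mdist c c' <= \sum_(c <- s) \sum_(c' <- s) mdist c c'.
  apply: (@le_trans _ _ (\sum_(c' <- s) mdist c c')).
    by rewrite (big_rem c')//= lerDl; apply: sumr_ge0 => ? _; exact: mdist_ge0.
  rewrite [leRHS](big_rem c)//= lerDl.
  by apply: sumr_ge0 => ? _; apply: sumr_ge0 => ? _; exact: mdist_ge0.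
have := metric_triangle a c b; have := metric_triangle c c' b.
rewrite (metric_sym c' b); lra.
Qed.

(** A measurable partition into small cells, with a centre for each: a finite
    net, and one of the net points selected measurably. *)
Lemma compact_labels (e : R) : 0 < e ->
  exists (p : nat) (cc : 'I_p -> X) (g : X -> 'I_p),
    measurable_label g /\ forall x, mdist x (cc (g x)) < e.
Proof.
move=> e0; have [s Hs] := compact_net e0.
pose cc j := tnth (in_tuple s) j.
have [||g [mg gE]] := @measurable_select _ X 'I_(size s) (fun j x => mdist x (cc j) < e).
- by move=> j; apply: measurable_fun_ltr => //; exact: measurable_mdist.
- move=> x; have [c /(nthP c)[j jlt jc] xc] := Hs x.
  by exists (Ordinal jlt); rewrite /cc (tnth_nth c)/= jc.
- by exists (size s), cc, g.
Qed.

(** The distance of two measurable maps is a limit of distances in which the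
    first map is replaced by a map with finitely many values. *)
Lemma measurable_fun_mdist d' (S : measurableType d') (u v : S -> X) :
  measurable_fun setT u -> measurable_fun setT v ->
  measurable_fun setT (fun w => mdist (u w) (v w)).
Proof.
move=> mu mv.
have /choice[h Hh] k : exists h : S -> R, measurable_fun setT h /\
    forall w, `|mdist (u w) (v w) - h w| < k.+1%:R^-1.
  have k0 : 0 < k.+1%:R^-1 :> R by rewrite invr_gt0.
  have [p [cc [g [mg gE]]]] := compact_labels k0.
  exists (fun w => mdist (v w) (cc (g (u w)))); split.
    apply: (@measurable_fun_piecewise _ S _ (measurableTypeR R) _ (g \o u)
      (fun i w => mdist (v w) (cc i))).
      exact: measurable_label_precomp.
    by move=> i; exact: (measurableT_comp (measurable_mdist (cc i))).
  move=> w; rewrite (metric_sym (u w)).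
  by apply: le_lt_trans (gE (u w)); rewrite (le_trans (mdist_diff _ _ _)).
apply: (@measurable_fun_cvg _ _ _ _ h); first by move=> k; have [] := Hh k.
move=> w _; apply/cvgrPdist_lt => e e0.
have [N HN] := nat_ge e^-1.
exists N => // k /= Nk; have [_ /(_ w) H] := Hh k.
apply: (lt_le_trans H); rewrite invf_ple ?posrE// (le_trans (HN k Nk))//.
by rewrite ler_nat.
Qed.

End compact_borel.

(** * Mutual information of finite-valued maps *)

Section finite_information.
Context (R : realType).

(** The mutual information of the joint law [p] of a pair. *)
Definition joint_info (I J : finType) (p : I -> J -> R) : R :=
  \sum_i \sum_j p i j *
    (ln (p i j) - ln (\sum_j' p i j') - ln (\sum_i' p i' j)).

Lemma mul_ln_le_ln (x y : R) : 0 <= x <= y -> x * ln x <= x * ln y.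
Proof.
move=> /andP[]; rewrite le_eqVlt => /predU1P[<-|x0 xy]; first by rewrite !mul0r.
by rewrite ler_pM2l// ler_ln// posrE// (lt_le_trans x0).
Qed.

(** The tangent line of the logarithm at 1, applied to [1 / (k * x)]. *)
Lemma mul_lnV_le (x k : R) : 0 <= x -> 0 < k -> x * (- ln x) <= x * ln k + k^-1 - x.
Proof.
rewrite le_eqVlt => /predU1P[<-|x0] k0.
  by rewrite !mul0r add0r subr0 invr_ge0 ltW.
have := @le_ln1Dx R ((k * x)^-1 - 1).
rewrite addrCA subrr addr0 lnV ?posrE ?mulr_gt0// lnM ?posrE// => H.
have {H} : - (ln k + ln x) <= (k * x)^-1 - 1.
  by apply: H; rewrite ltrBrDr addNr invr_gt0 mulr_gt0.
rewrite -(ler_pM2l x0) mulrBr mulr1 invfM mulrCA mulfV ?gt_eqF// mulr1.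
lra.
Qed.

Lemma fin_entropy_le (I : finType) (p : I -> R) (k : nat) :
  (forall i, 0 <= p i) -> \sum_i p i = 1 -> (#|[pred i | (p i != 0)%R]| <= k)%N ->
  - \sum_i p i * ln (p i) <= ln k%:R.
Proof.
move=> p0 p1 pk.
have k0 : (0 < k)%N.
  case: k pk => // /[!leqn0]/eqP/card0_eq H.
  move: p1; rewrite big1 => [/esym/eqP|i _]; first by rewrite oner_eq0.
  by have := H i; rewrite inE => /negbFE/eqP.
have k0' : 0 < (k%:R : R) by rewrite ltr0n.
rewrite -sumrN (bigID [pred i | (p i != 0)%R])/= [X in _ + X]big1 ?addr0; last first.
  by move=> i /negPn/eqP ->; rewrite mul0r oppr0.
apply: (@le_trans _ _ (\sum_(i | p i != 0) (p i * ln k%:R + k%:R^-1 - p i))).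
  by apply: ler_sum => i _; rewrite -mulrN mul_lnV_le.
rewrite sumrB big_split/= -mulr_suml.
have -> : \sum_(i | p i != 0) p i = 1.
  rewrite -p1 [RHS](bigID [pred i | (p i != 0)%R])/= [X in _ + X]big1 ?addr0//.
  by move=> i /negPn/eqP.
rewrite mul1r sumr_const -[leRHS]addr0 -addrA lerD2l subr_le0.
rewrite -[leLHS]mulr_natr mulrC ler_pdivrMr// mul1r ler_nat.
by apply: leq_trans pk; apply: eq_leq; apply: eq_card => i.
Qed.

(** The information is at most the entropy of the second coordinate, since each
    [p i j] is at most the marginal; and an entropy is at most the logarithm of
    the size of the support. *)
Lemma joint_info_le (I J : finType) (p : I -> J -> R) (k : nat) :
  (forall i j, 0 <= p i j) -> \sum_i \sum_j p i j = 1 ->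
  (#|[pred j | (\sum_i p i j != 0)%R]| <= k)%N -> joint_info p <= ln k%:R.
Proof.
move=> p0 p1 pk; apply: le_trans (fin_entropy_le _ _ pk); first last.
- by rewrite exchange_big.
- by move=> j; apply: sumr_ge0.
have -> : - \sum_j (\sum_i p i j) * ln (\sum_i p i j) =
    \sum_i \sum_j p i j * (- ln (\sum_i p i j)).
  rewrite exchange_big/= -sumrN; apply: eq_bigr => j _.
  by rewrite -mulrN mulr_suml.
apply: ler_sum => i _; apply: ler_sum => j _.
rewrite !mulrDr gerDr mulrN subr_le0; apply: mul_ln_le_ln; rewrite p0/=.
by rewrite (bigD1 j)//= lerDl sumr_ge0.
Qed.

End finite_information.

Section information_of_labels.
Context d (Omega : measurableType d) (R : realType) (P : probability Omega R).

Definition law (I : Type) (L : Omega -> I) (i : I) : R := fine (P (L @^-1` [set i])).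

Lemma law_ge0 (I : Type) (L : Omega -> I) i : 0 <= law L i.
Proof. by rewrite fine_ge0. Qed.

Lemma shannon_entropy_law (I : finType) (S : choiceType) (L : Omega -> I)
  (enc : I -> S) : injective enc ->
  shannon_entropy P (enc \o L) = - \sum_i law L i * ln (law L i).
Proof.
move=> einj; rewrite /shannon_entropy; congr (- _).
rewrite (fsbig_fwiden (map enc (enum I))).
- rewrite big_map big_enum; apply: eq_bigr => i _.
  rewrite (_ : (enc \o L) @^-1` [set enc i] = L @^-1` [set i])//.
  by apply/seteqP; split => x /= => [/einj|->].
- by move=> _ [x _ <-]/=; apply: map_f; rewrite mem_enum.
- by rewrite map_inj_uniq// enum_uniq.
- move=> z [_ nz] /=.
  rewrite (_ : (enc \o L) @^-1` [set z] = set0) ?measure0/= ?mul0r//.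
  by rewrite -subset0 => x /= xz; apply: nz; exists x.
Qed.

Lemma measure_label_sum (I : finType) (L : Omega -> I) (B : pred I) :
  measurable_label L -> P (L @^-1` [set` B]) = (\sum_(i | B i) law L i)%:E.
Proof.
move=> mL.
have -> : L @^-1` [set` B] = \bigcup_(i in [set` B]) (L @^-1` [set i]).
  by apply/seteqP; split => x /=; [move=> Bx; exists (L x)|move=> [i Bi ->]].
rewrite measure_fin_bigcup//=; last by move=> i j _ _ [x [<- <-]].
rewrite (fsbig_fwiden (enum B)) ?enum_uniq//.
- rewrite big_enum/= -sumEFin; apply: eq_bigr => i _.
  by rewrite fineK// fin_num_measure.
- by move=> i /= Bi; rewrite mem_enum.
- by move=> i [/=]; rewrite mem_enum.
Qed.

Lemma law_sum1 (I : finType) (L : Omega -> I) : measurable_label L ->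
  \sum_i law L i = 1.
Proof.
move=> mL; apply: EFin_inj; rewrite -(measure_label_sum predT mL).
by rewrite -(@probability_setT _ _ _ P); congr (P _); apply/seteqP.
Qed.

Lemma law_comp (I : finType) (J : eqType) (L : Omega -> I) (g : I -> J) j :
  measurable_label L -> law (g \o L) j = \sum_(i | g i == j) law L i.
Proof.
move=> mL; rewrite /law.
rewrite (_ : (g \o L) @^-1` [set j] = L @^-1` [set` [pred i | g i == j]]).
  by rewrite measure_label_sum.
by apply/seteqP; split => x /= /eqP.
Qed.

Lemma law_pair_l (I J : finType) (L1 : Omega -> I) (L2 : Omega -> J) i :
  measurable_label (fun w => (L1 w, L2 w)) ->
  law L1 i = \sum_j law (fun w => (L1 w, L2 w)) (i, j).
Proof.
set L := fun w => (L1 w, L2 w) => mL.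
rewrite (law_comp (L := L) fst)// [RHS](reindex_onto (fun ij => ij.2) (fun j => (i, j)))//=.
apply: eq_big => -[i' j]/=; last by move=> /eqP ->.
by apply/eqP/eqP => [->//|[]].
Qed.

Lemma law_pair_r (I J : finType) (L1 : Omega -> I) (L2 : Omega -> J) j :
  measurable_label (fun w => (L1 w, L2 w)) ->
  law L2 j = \sum_i law (fun w => (L1 w, L2 w)) (i, j).
Proof.
set L := fun w => (L1 w, L2 w) => mL.
rewrite (law_comp (L := L) snd)// [RHS](reindex_onto (fun ij => ij.1) (fun i => (i, j)))//=.
apply: eq_big => -[i j']/=; last by move=> /eqP ->.
by apply/eqP/eqP => [->//|[]].
Qed.

(** Marginal entropies are sums against the joint law, so the three entropies
    combine into one sum. The injections [e1] and [e2] allow labels of any finite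
    type to be read as natural numbers, the labels used by [mutual_info]. *)
Lemma finite_mutual_info_law (I J : finType) (S1 S2 : choiceType)
  (L1 : Omega -> I) (L2 : Omega -> J) (e1 : I -> S1) (e2 : J -> S2) :
  injective e1 -> injective e2 ->
  measurable_label (fun w => (L1 w, L2 w)) ->
  finite_mutual_info P (e1 \o L1) (e2 \o L2) =
  joint_info (fun i j => law (fun w => (L1 w, L2 w)) (i, j)).
Proof.
move=> i1 i2 mL; rewrite /finite_mutual_info.
set L := fun w => (L1 w, L2 w) in mL *.
have -> : (fun w => ((e1 \o L1) w, (e2 \o L2) w)) = (fun ij => (e1 ij.1, e2 ij.2)) \o L by [].
rewrite !shannon_entropy_law//; last first.
  by move=> [i j] [i' j'] /= [/i1 -> /i2 ->].
have l1 i : law L1 i = \sum_j law L (i, j) by exact: law_pair_l.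
have l2 j : law L2 j = \sum_i law L (i, j) by exact: law_pair_r.
have -> : \sum_i law L1 i * ln (law L1 i) = \sum_i \sum_j law L (i, j) * ln (law L1 i).
  by apply: eq_bigr => i _; rewrite {1}l1 mulr_suml.
have -> : \sum_j law L2 j * ln (law L2 j) = \sum_i \sum_j law L (i, j) * ln (law L2 j).
  by rewrite exchange_big; apply: eq_bigr => i _; rewrite {1}l2 mulr_suml.
have -> : \sum_i law L i * ln (law L i) = \sum_i \sum_j law L (i, j) * ln (law L (i, j)).
  by rewrite pair_big; apply: eq_bigr => -[].
rewrite opprK /joint_info -!sumrN -!big_split/=; apply: eq_bigr => i _.
rewrite -!sumrN -!big_split/=; apply: eq_bigr => j _.
by rewrite -l1 -l2; ring.
Qed.

End information_of_labels.

(** * Codes for orbits *)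

Lemma size_flatten_map (I A : Type) (f : I -> seq A) (s : seq I) :
  size (flatten [seq f i | i <- s]) = (\sum_(i <- s) size (f i))%N.
Proof. by rewrite size_flatten sumnE !big_map. Qed.

Section codes.
Context (R : realType) (X : metricType R) (T : X -> X) (x0 : X).

(** The point [x0] is the default value of [nth], and also the symbol used where
    nothing is said about the orbit. *)
Definition word_cost (m : nat) (x : X) (w : seq X) : R :=
  \sum_(i < m) mdist (iter i T x) (nth x0 w i).

(** The total cost [b] is a parameter of its own, rather than a cost per symbol
    times [m], so that codes for successive stretches of time concatenate. *)
Definition codes (W : seq (seq X)) (m : nat) (x : X) (b : R) :=
  exists w, [/\ w \in W, size w = m & word_cost m x w <= b].

Lemma codes_le W m x b b' : b <= b' -> codes W m x b -> codes W m x b'.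
Proof. by move=> bb' [w [wW sw wb]]; exists w; split => //; exact: le_trans bb'. Qed.

Lemma codes_sub W W' m x b : {subset W <= W'} -> codes W m x b -> codes W' m x b.
Proof. by move=> WW' [w [wW sw wb]]; exists w; split => //; exact: WW'. Qed.

Definition code_cat (W1 W2 : seq (seq X)) := [seq w1 ++ w2 | w1 <- W1, w2 <- W2].

Lemma codes_cat W1 W2 m1 m2 x b1 b2 : codes W1 m1 x b1 ->
  codes W2 m2 (iter m1 T x) b2 -> codes (code_cat W1 W2) (m1 + m2) x (b1 + b2).
Proof.
move=> [w1 [wW1 s1 wb1]] [w2 [wW2 s2 wb2]]; exists (w1 ++ w2); split.
- by apply/allpairsP; exists (w1, w2).
- by rewrite size_cat s1 s2.
- rewrite /word_cost big_split_ord/=; apply: lerD.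
    apply: le_trans wb1; apply: ler_sum => i _.
    by rewrite nth_cat s1 ltn_ord.
  apply: le_trans wb2; apply: ler_sum => i _.
  by rewrite nth_cat s1 ltnNge leq_addr/= addKn addnC iterD.
Qed.

Lemma codes_const (D : R) j x : (forall x y : X, mdist x y <= D) ->
  codes [:: nseq j x0] j x (j%:R * D).
Proof.
move=> mD; exists (nseq j x0); split; rewrite ?mem_head ?size_nseq//.
apply: (@le_trans _ _ (\sum_(i < j) D)); first exact: ler_sum.
by rewrite sumr_const card_ord mulr_natl.
Qed.

Lemma codes_net (e : R) (s : seq X) q :
  (forall x, exists2 c, c \in s & mdist x c < e) ->
  exists2 W, size W = (size s ^ q)%N & forall x, codes W q x (q%:R * e).
Proof.
move=> Hs; elim: q => [|q [W sW HW]].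
  exists [:: [::]] => // x; exists [::]; split => //.
  by rewrite /word_cost big_ord0 mul0r.
exists (code_cat [seq [:: c] | c <- s] W).
  by rewrite size_allpairs size_map sW expnS.
move=> x; rewrite -add1n natrD mulrDl; apply: codes_cat; last exact: HW.
have [c cs xc] := Hs x; exists [:: c]; split => //.
  by apply/mapP; exists c.
by rewrite /word_cost big_ord1/= mul1r ltW.
Qed.

(** Orbits are described block by block: after a delay [j < J], a block of length
    [n] issued from a point of [A n] is described by a word of [V n]; elsewhere,
    and during the delays, the constant symbol [x0] is used. The words obtained
    for length [m] are those of length [m - 1] preceded by [x0], and those of
    length [m - j - n] preceded by a delay and a word of [V n]. The exponential
    bound [expR (c' * m)] propagates through this recursion because
    [expR (- c') + J * \sum_n expR ((c - c') * n) <= 1]; the positions of the blocks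
    thus cost nothing beyond the passage from [c] to [c']. *)
Lemma tiling_code (A : (set X)^nat) (V : nat -> seq (seq X))
    (c c' D eps eta : R) (J N0 N1 : nat) (H := tile_set T A J N0 N1) :
  (forall x y : X, mdist x y <= D) -> 0 <= c' -> 0 <= D -> 0 <= eps -> 0 <= eta ->
  (0 < N0)%N -> J%:R <= eta * N0%:R ->
  (forall n y, A n y -> codes (V n) n y (n%:R * eps)) ->
  (forall n, (N0 <= n)%N -> (size (V n))%:R <= expR (c * n%:R)) ->
  J%:R * \sum_(N0 <= n < N1) expR ((c - c') * n%:R) <= 1 - expR (- c') ->
  forall m, exists2 W, (size W)%:R <= expR (c' * m%:R) &
    forall x, codes W m x
      (m%:R * eps + D * (orbit_sum T \1_(~` H) m x + eta * m%:R + (N1 + J)%:R)).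
Proof.
move=> mD c'0 D0 eps0 eta0 N00 JN AV sV geo; elim/ltn_ind => m IH.
have i0 m' x' : 0 <= orbit_sum T (\1_(~` H) : X -> R) m' x'.
  by apply: orbit_sum_ge0 => y; rewrite indicE.
(* Below this length a block need not fit, and a constant word is enough. *)
have [mN|Nm] := ltnP m (N1 + J).+1.
  exists [:: nseq m x0] => /=; first by rewrite -expR0 ler_expR mulr_ge0.
  move=> x; apply: codes_le (codes_const m x mD).
  have : (m%:R : R) <= (N1 + J)%:R by rewrite ler_nat.
  have : 0 <= m%:R * eps by rewrite mulr_ge0.
  have : 0 <= D * (orbit_sum T \1_(~` H) m x + eta * m%:R).
    by rewrite mulr_ge0// addr_ge0// mulr_ge0.
  set M := m%:R => h1 h2 /(ler_wpM2l D0); rewrite mulrDr; lra.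
have /choice[W' HW'] k : exists W, (k < m)%N -> (size W)%:R <= expR (c' * k%:R) /\
    forall x, codes W k x
      (k%:R * eps + D * (orbit_sum T \1_(~` H) k x + eta * k%:R + (N1 + J)%:R)).
  by have [/IH[W sW HW]|_] := ltnP k m; [exists W|exists [::]].
pose W1 := code_cat [:: nseq 1 x0] (W' m.-1).
pose W2 (jn : nat * nat) := code_cat [:: nseq jn.1 x0]
  (code_cat (V jn.2) (W' (m - (jn.1 + jn.2))%N)).
pose idx := [seq (j, n) | j <- iota 0 J, n <- index_iota N0 N1].
exists (W1 ++ flatten [seq W2 jn | jn <- idx]).
  rewrite size_cat size_flatten_map natrD natr_sum.
  have e1 : (size W1)%:R <= expR (c' * m%:R) * expR (- c').
    rewrite size_allpairs/= mul1n.
    have [|+ _] := HW' m.-1; first by lia.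
    rewrite -expRD; congr (_ <= expR _).
    by case: m Nm {IH HW' W' W1 W2} => // m _; rewrite /= -[in RHS]natr1; ring.
  apply: (@le_trans _ _ (expR (c' * m%:R) * expR (- c') + expR (c' * m%:R) *
    (J%:R * \sum_(N0 <= n < N1) expR ((c - c') * n%:R)))); last first.
    rewrite -mulrDr -[leRHS]mulr1 ler_pM2l ?expR_gt0//; lra.
  apply: lerD => //.
  have -> : expR (c' * m%:R) * (J%:R * \sum_(N0 <= n < N1) expR ((c - c') * n%:R)) =
     \sum_(jn <- idx) expR (c' * m%:R) * expR ((c - c') * jn.2%:R).
    rewrite big_allpairs/= -{2}(subn0 J) sumr_const_nat subn0 -mulr_sumr.
    by rewrite -mulrnAr mulr_natl.
  rewrite big_seq [leRHS]big_seq; apply: ler_sum => -[j n] /allpairsP[[j' n'] /= [+ + [-> ->]]].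
  rewrite mem_iota mem_index_iota /= add0n => jJ /andP[Nn nN].
  have jnm : (j' + n' <= m)%N by lia.
  rewrite !size_allpairs/= mul1n natrM.
  have [|s1 _] := HW' (m - (j' + n'))%N; first by lia.
  apply: (@le_trans _ _ (expR (c * n'%:R) * expR (c' * (m - (j' + n'))%:R))).
    by apply: ler_pM => //; exact: sV.
  rewrite -!expRD ler_expR natrB// natrD.
  have : 0 <= c' * j'%:R by rewrite mulr_ge0.
  nra.
(* Outside [H] a single symbol is spent, and the indicator pays for it. *)
move=> x; have [Hx|Hx] := pselect (H x); last first.
  apply: (@codes_sub W1); first by move=> w ww; rewrite mem_cat ww.
  case: m Nm {IH} HW' @W1 @W2 => // m Nm HW' W1 _.
  have [//|_ HW] := HW' m.
  have := codes_cat (codes_const 1 x mD) (HW (T x)).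
  rewrite add1n; apply: codes_le; rewrite orbit_sumS indicE.
  have -> : x \in ~` H by rewrite in_setC; apply/negP; rewrite inE.
  rewrite -!natr1 /=.
  have : 0 <= D * eta by rewrite mulr_ge0.
  set o := orbit_sum _ _ _ _; set k := (N1 + J)%:R; set M := m%:R.
  nra.
(* In [H] the delay costs at most [D * J], which is at most [D * eta * n]. *)
have [j [n [jJ /andP[Nn nN] An]]] := Hx.
have jnm : (j + n <= m)%N by lia.
apply: (@codes_sub (W2 (j, n))).
  move=> w ww; rewrite mem_cat; apply/orP; right; apply/flatten_mapP.
  exists (j, n) => //; apply/allpairsP; exists (j, n); split => //=.
    by rewrite mem_iota.
  by rewrite mem_index_iota Nn.
have [|_ HW] := HW' (m - (j + n))%N; first by lia.
have := codes_cat (codes_const j x mD) (codes_cat (AV _ _ An) (HW _)).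
rewrite addnA subnKC//; apply: codes_le.
rewrite -iterD [(n + j)%N]addnC.
have := i0 (j + n)%N x.
have -> : orbit_sum T \1_(~` H) m x = orbit_sum T \1_(~` H) (j + n) x +
    orbit_sum T (\1_(~` H) : X -> R) (m - (j + n))%N (iter (j + n) T x).
  by rewrite -orbit_sumD subnKC.
have : (j%:R : R) <= eta * n%:R.
  apply: (@le_trans _ _ J%:R); first by rewrite ler_nat ltnW.
  by apply: (le_trans JN); rewrite ler_wpM2l// ler_nat.
move=> /(ler_wpM2l D0).
have : 0 <= D * (eta * j%:R) by rewrite !mulr_ge0.
have : 0 <= j%:R * eps by rewrite mulr_ge0.
rewrite natrB// natrD.
set o := orbit_sum _ _ (m - _) _; set o' := orbit_sum _ _ _ _; set k := (N1 + J)%:R.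
move=> ? ? ? /(mulr_ge0 D0); lra.
Qed.

End codes.

(** * Couplings defined by codes *)

Lemma finite_set_nat_bound (A : set nat) : finite_set A ->
  exists N, forall x, A x -> (x < N)%N.
Proof.
move=> /finite_seqP[s ->]; exists (\max_(i <- s) i).+1 => x /= xs.
by rewrite ltnS; exact: leq_bigmax_seq.
Qed.

Section coding_rate.
Context d (R : realType) (X : measurableMetricType d R) (T : X -> X)
  (mu : probability X R) (x0 : X).
Context (X_borel : @measurable d X = <<s @open X >>) (T_cont : continuous T).

(** A second variable that factors through [K] labels carries at most [ln K] of
    information, whatever the maps used to discretize both variables. *)
Lemma mutual_info_le_label d1 d2 (S1 : measurableType d1) (S2 : measurableType d2)
    d0 (Omega : measurableType d0) (P : probability Omega R)
    (K : nat) (x : Omega -> S1) (g : Omega -> 'I_K) (h : 'I_K -> S2) :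
  measurable_fun setT x -> measurable_label g ->
  (mutual_info P x (h \o g) <= (ln K%:R)%:E)%E.
Proof.
move=> mx mg; apply: ge_ereal_sup => _ [a [b [fa fb ->]]]; rewrite lee_fin.
have [N aN] := finite_set_nat_bound fa; have [M bM] := finite_set_nat_bound fb.
pose La w : 'I_N := Ordinal (aN _ (imageT a (x w))).
pose cb k : 'I_M := Ordinal (bM _ (imageT b (h k))).
have mLa : measurable_label La.
  apply: measurable_label_fiber => i.
  have -> : La @^-1` [set i] = x @^-1` (a @^-1` [set val i]).
    by apply/seteqP; split => w /= => [<-//|H]; exact: val_inj.
  rewrite -[X in measurable X]setTI; apply: mx => //.
  by rewrite -[X in measurable X]setTI; exact: measurable_funPT.
have mL : measurable_label (fun w => (La w, (cb \o g) w)).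
  apply: measurable_label_fiber => -[i j].
  have -> : (fun w => (La w, (cb \o g) w)) @^-1` [set (i, j)] =
      La @^-1` [set i] `&` g @^-1` (cb @^-1` [set j]).
    by apply/seteqP; split => w /= => [[<- <-]|[<- <-]].
  by apply: measurableI; [exact: mLa|exact: mg].
have := finite_mutual_info_law P (@val_inj _ _ _ : injective (val : 'I_N -> nat))
  (@val_inj _ _ _ : injective (val : 'I_M -> nat)) mL.
rewrite (_ : val \o La = a \o x)// (_ : val \o (cb \o g) = b \o (h \o g))// => ->.
apply: joint_info_le.
- by move=> i j; exact: law_ge0.
- by rewrite pair_big/= -(law_sum1 P mL); apply: eq_bigr => -[].
- apply: (@leq_trans (size (codom cb))); last by rewrite size_codom card_ord.
  apply: leq_trans (card_size _); apply: subset_leq_card.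
  apply/fintype.subsetP => j; rewrite inE => jn0.
  have [[w wj]|nw] := pselect (exists w, cb (g w) = j); first by rewrite -wj codom_f.
  move: jn0; rewrite big1 ?eqxx// => i _.
  rewrite /law (_ : _ @^-1` _ = set0) ?measure0// -subset0 => w /= -[_ wj].
  by apply: nw; exists w.
Qed.

Lemma measurable_word_cost m (w : seq X) :
  measurable_fun setT (fun x => word_cost T x0 m x w).
Proof.
apply: measurable_sum => i.
apply: (measurableT_comp (measurable_mdist X_borel (nth x0 w i))).
exact/measurable_iter/continuous_borel.
Qed.

(** A code yields a coupling: [X] itself is the probability space, [x] the
    identity, and [y] a word whose cost does not exceed [f x]. Comparing
    with [f] rather than minimizing the cost keeps the selection measurable. *)
Lemma rate_distortion_le_code (W : seq (seq X)) (m : nat) (eps : R) (f : X -> R) :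
  (0 < m)%N -> measurable_fun setT f -> (forall x, 0 <= f x) ->
  (forall x, codes T x0 W m x (f x)) ->
  (\int[mu]_x (f x)%:E <= (m%:R * eps)%:E)%E ->
  (rate_distortion T mu eps <= (m%:R^-1 * ln (size W)%:R)%:E)%E.
Proof.
move=> m0 mf f0 HW intf.
have [||g [mg gE]] := @measurable_select _ X 'I_(size W)
    (fun k x => word_cost T x0 m x (nth [::] W k) <= f x).
- by move=> k; apply: measurable_fun_ler => //; exact: measurable_word_cost.
- move=> x; have [w [/(nthP [::])[k kW <-] _ wf]] := HW x.
  by exists (Ordinal kW).
pose h (k : 'I_(size W)) : m.-tuple X := [tuple nth x0 (nth [::] W k) i | i < m].
have my : measurable_fun setT (h \o g) by exact: measurable_fun_label.
have mx : measurable_fun setT (@idfun X) by exact: measurable_id.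
pose y : {RV mu >-> m.-tuple X} := HB.pack (h \o g) (isMeasurableFun.Build _ _ _ _ _ my).
pose x : {RV mu >-> X} := HB.pack (@idfun X) (isMeasurableFun.Build _ _ _ _ _ mx).
apply: (@le_trans _ _ ((m%:R^-1)%:E * mutual_info mu x y)%E); last first.
  rewrite EFinM lee_pmul2l ?lte_fin ?invr_gt0 ?ltr0n//.
  exact: mutual_info_le_label.
apply: ereal_inf_lbound; exists m, d, X, mu, x, y; split => //; split => //.
have m0' : 0 < (m%:R : R) by rewrite ltr0n.
rewrite unlock.
apply: (@le_trans _ _ (\int[mu]_x ((m%:R^-1)%:E * (f x)%:E))%E).
  have costE t : \sum_(k < m) mdist (iter k T t) (tnth (h (g t)) k) =
      word_cost T x0 m t (nth [::] W (g t)).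
    by apply: eq_bigr => k _; rewrite tnth_mktuple.
  apply: ge0_le_integral => //=.
  - move=> t _; rewrite lee_fin mulr_ge0//; apply: sumr_ge0 => k _; exact: mdist_ge0.
  - apply/measurable_EFinP/measurable_funM => //.
    under eq_fun do rewrite costE.
    have := @measurable_fun_piecewise _ X _ (measurableTypeR R) _ g
      (fun k t => word_cost T x0 m t (nth [::] W k)) mg.
    by apply=> i; exact: measurable_word_cost.
  - by apply/measurable_EFinP/measurable_funM.
  - by move=> t _; rewrite -EFinM lee_fin ler_pM2l ?invr_gt0// costE.
rewrite ge0_integralZl_EFin//=; last 2 first.
- by move=> t _; rewrite lee_fin.
- exact/measurable_EFinP.
apply: (@le_trans _ _ ((m%:R^-1)%:E * (m%:R * eps)%:E)%E).
  by rewrite lee_wpmul2l// lee_fin invr_ge0 ltW.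
by rewrite -EFinM mulKf// gt_eqF.
Qed.

End coding_rate.

(** * The rate distortion function is at most the average entropy *)

Section ereal_facts.
Context (R : realType).
Implicit Types (u : (\bar R)^nat) (x y l : \bar R).

Lemma limn_esup_lt u l : (limn_esup u < l)%E ->
  exists N, forall n, (N <= n)%N -> (u n < l)%E.
Proof.
move=> /ereal_inf_lt[_ [V [N _ NV] <-] Vl]; exists N => n Nn.
apply: le_lt_trans Vl; apply: ereal_sup_ubound; exists n => //; exact: NV.
Qed.

Lemma limn_esup_le u l N : (forall n, (N <= n)%N -> (u n <= l)%E) ->
  (limn_esup u <= l)%E.
Proof.
move=> ul; apply: (@le_trans _ _ (ereal_sup (u @` [set n | (N <= n)%N]))).
  by apply: ereal_inf_lbound; exists [set n | (N <= n)%N] => //; exists N.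
by apply: ge_ereal_sup => _ [n Nn <-]; exact: ul.
Qed.

Lemma limn_esup_ge u l : (forall n, (l <= u n)%E) -> (l <= limn_esup u)%E.
Proof.
move=> lu; rewrite leNgt; apply/negP => /limn_esup_lt[N H].
by have := H N (leqnn N); rewrite ltNge lu.
Qed.

Lemma lee_lt_real x y : (0 <= y)%E -> (forall t : R, (y < t%:E)%E -> (x <= t%:E)%E) ->
  (x <= y)%E.
Proof.
case: y => [r _ H|_ _|]; [|by rewrite leey|by []].
apply/lee_addgt0Pr => e e0; rewrite -EFinD; apply: H.
by rewrite lte_fin ltrDl.
Qed.

Lemma geometric_tail (r e : R) : 0 <= r < 1 -> 0 < e ->
  exists N, forall N0 N1, (N <= N0)%N -> \sum_(N0 <= n < N1) r ^+ n <= e.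
Proof.
move=> /andP[r0 r1] e0.
have r1' : 0 < 1 - r by rewrite subr_gt0.
have e1 : 0 < e * (1 - r) by rewrite mulr_gt0.
have : (fun n => r ^+ n) @ \oo --> (0 : R) by apply: cvg_expr; rewrite ger0_norm.
move=> /cvgrPdist_lt /(_ _ e1)[N _ HN]; exists N => N0 N1 NN0.
have [N10|N01] := leqP N1 N0; first by rewrite big_geq// ltW.
rewrite -(ler_pM2r r1') mulr_suml.
have -> : \sum_(N0 <= n < N1) r ^+ n * (1 - r) = r ^+ N0 - r ^+ N1.
  elim: N1 N01 => // k IH; rewrite ltnS leq_eqVlt => /predU1P[<-|Nk].
    by rewrite big_nat1 exprS; ring.
  by rewrite big_nat_recr ?(ltnW Nk)//= IH// exprS; ring.
have := HN _ NN0; rewrite /= sub0r normrN ger0_norm ?exprn_ge0// => ?.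
have : 0 <= r ^+ N1 by rewrite exprn_ge0.
lra.
Qed.

(** For [N0] large, the condition under which the sizes of the codes of
    [tiling_code] obey their exponential bound. *)
Lemma transition_budget (J : nat) (c c' : R) : c < c' -> 0 < c' ->
  exists N, forall N0 N1, (N <= N0)%N ->
    J%:R * \sum_(N0 <= n < N1) expR ((c - c') * n%:R) <= 1 - expR (- c').
Proof.
move=> cc' c'0.
have [||N H] := @geometric_tail (expR (c - c')) ((1 - expR (- c')) / (J%:R + 1)).
- by rewrite expR_ge0/= expR_lt1 subr_lt0.
- by apply: divr_gt0; [rewrite subr_gt0 expR_lt1 oppr_lt0|rewrite ltr_wpDl].
exists N => N0 N1 nN; have := H N0 N1 nN; rewrite ler_pdivlMr ?ltr_wpDl//.
under [in X in _ -> X]eq_bigr do rewrite expRM_natr.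
have : 0 <= \sum_(N0 <= n < N1) expR (c - c') ^+ n.
  by apply: sumr_ge0 => i _; rewrite exprn_ge0// expR_ge0.
rewrite mulrDr mulr1 mulrC; lra.
Qed.

Lemma padded_rate_le (c t m q l : R) : 0 <= l -> c < t -> 0 <= t -> 0 <= m -> 0 <= q ->
  q <= m * (t - c) / (2 * (l + 1)) + 1 -> 2 * l <= m * (t - c) ->
  c * m + q * l <= (m + q) * t.
Proof.
move=> l0 ct t0 m0 q0 hq hl.
have tc : 0 <= t - c by rewrite subr_ge0 ltW.
have l1 : 0 < l + 1 by rewrite ltr_wpDl.
have h1 : q * l <= (m * (t - c) / (2 * (l + 1)) + 1) * l by rewrite ler_wpM2r.
have h2 : m * (t - c) / (2 * (l + 1)) * l <= m * (t - c) / 2.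
  have -> : m * (t - c) / (2 * (l + 1)) * l = m * (t - c) / 2 * (l / (l + 1)).
    by field; rewrite gt_eqF.
  by rewrite ler_piMr ?divr_ge0 ?mulr_ge0// ler_pdivrMr// mul1r lerDl.
have h3 : 0 <= q * t by rewrite mulr_ge0.
move: h1 h2; rewrite mulrDl mul1r; lra.
Qed.

End ereal_facts.

Section upper_bound.
Context d (R : realType) (X : measurableMetricType d R) (T : X -> X)
  (mu : probability X R).

(** An empty cover would give a set of measure 0 larger than [1 - delta]. *)
Lemma avg_cover_number_ge1 n (eps delta : R) : delta < 1 ->
  (1 <= avg_cover_number T mu n eps delta)%E.
Proof.
move=> d1; apply: le_ereal_inf_tmp => _ [s -> [A [mA muA As]]].
rewrite lee_fin ler1n lt0n size_eq0; apply/negP => /eqP s0.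
move: As; rewrite s0 => As; have A0 : A = set0.
  by rewrite -subset0 => x /As[].
by move: muA; rewrite A0 measure0 lte_fin subr_lt0 ltNge (ltW d1).
Qed.

Lemma avg_entropy_ge0 (eps delta : R) : delta < 1 -> (0 <= avg_entropy T mu eps delta)%E.
Proof.
move=> d1; apply: limn_esup_ge => n; apply: mule_ge0.
  by rewrite lee_fin invr_ge0.
by rewrite lne_ge0 avg_cover_number_ge1.
Qed.

Lemma avg_entropy_lt_cover (eps delta c : R) :
  (avg_entropy T mu eps delta < c%:E)%E -> delta < 1 ->
  exists N, forall n, (N <= n)%N -> exists s : seq X,
    (size s)%:R <= expR (c * n%:R) /\
    exists A, [/\ measurable A, ((1 - delta)%:E < mu A)%E &
      A `<=` \bigcup_(x in [set` s]) avg_ball T n eps x].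
Proof.
move=> /limn_esup_lt[N HN] d1; exists N.+1 => n Nn.
have n0 : 0 < (n%:R : R) by rewrite ltr0n (leq_trans _ Nn).
have := HN n (ltnW Nn).
rewrite lte_pdivrMl// -EFinM => H.
have c1 := avg_cover_number_ge1 n eps d1.
have : (avg_cover_number T mu n eps delta < (expR (n%:R * c))%:E)%E.
  rewrite -[X in (X < _)%E]lneK; last by rewrite in_itv/= leey (le_trans _ c1).
  by rewrite -[X in (_ < X)%E]/(expeR (n%:R * c)%:E) lte_expeR.
move=> /ereal_inf_lt[_ [s -> HA]]; rewrite lte_fin => sn.
by exists s; rewrite mulrC ltW.
Qed.

Context (x0 : X) (X_borel : @measurable d X = <<s @open X >>)
  (X_compact : compact [set: X]) (T_cont : continuous T)
  (mu_inv : invariant_measure T mu) (mu_erg : ergodic_measure T mu).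

Lemma avg_ball_codes (s : seq X) n (eps : R) y :
  (\bigcup_(x in [set` s]) avg_ball T n eps x) y ->
  codes T x0 [seq traject T c n | c <- s] n y (n%:R * eps).
Proof.
move=> [c /= cs cy]; exists (traject T c n); split.
- by apply/mapP; exists c.
- by rewrite size_traject.
case: n cy => [|n] cy; first by rewrite /word_cost big_ord0 mul0r.
rewrite mulrC -ler_pdivrMr ?ltr0n// mulrC ltW//.
move: cy; rewrite /avg_ball [X in X -> _]/= /avg_dist.
congr (_ * _ < _); apply: eq_bigr => i _.
by rewrite (set_nth_default c) ?size_traject// nth_traject// metric_sym.
Qed.

(** A code whose expected cost slightly exceeds [m * eps] is followed by [q]
    symbols described individually with accuracy [eps / 2]; their savings repay the
    excess. This replaces the right continuity of the rate distortion function. *)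
Lemma rate_distortion_le_padded_code (W : seq (seq X)) (s : seq X) (H : set X)
    (m q : nat) (b c eps eta D : R) :
  (0 < m)%N -> 0 < eps -> 0 <= D -> 0 <= b ->
  measurable H -> ((1 - eta)%:E < mu H)%E ->
  (size W)%:R <= expR (c * m%:R) ->
  (forall x, codes T x0 W m x (m%:R * eps + D * (orbit_sum T \1_(~` H) m x + b))) ->
  (forall x, exists2 y, y \in s & mdist x y < eps / 2) ->
  D * (eta * m%:R + b) <= q%:R * (eps / 2) ->
  (rate_distortion T mu eps <=
    ((m + q)%:R^-1 * (c * m%:R + q%:R * ln (size s)%:R))%:E)%E.
Proof.
move=> m0 eps0 D0 b0 mH muH sW HW Hs budget.
have [Wq sWq HWq] := codes_net T x0 q Hs.
have mT : measurable_fun setT T by exact: continuous_borel.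
have mi : measurable_fun setT (\1_(~` H) : X -> R).
  by apply: measurable_indic; exact: measurableC.
have i0 x : 0 <= (\1_(~` H) : X -> R) x by rewrite indicE.
pose a := m%:R * eps + D * b + q%:R * (eps / 2).
have a0 : 0 <= a.
  by rewrite !addr_ge0 ?mulr_ge0 ?divr_ge0 ?(ltW eps0).
pose f x := a + D * orbit_sum T \1_(~` H) m x.
have mo : measurable_fun setT (fun x => D * orbit_sum T \1_(~` H) m x).
  by apply: measurable_funM => //; exact: measurable_orbit_sum.
have HWf x : codes T x0 (code_cat W Wq) (m + q) x (f x).
  have := codes_cat (HW x) (HWq (iter m T x)); apply: codes_le.
  by rewrite /f /a mulrDr; lra.
apply: (le_trans (rate_distortion_le_code (f := f) X_borel T_cont _ _ _ HWf _)).
- by rewrite addn_gt0 m0.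
- exact: measurable_funD.
- by move=> x; rewrite addr_ge0// mulr_ge0// orbit_sum_ge0.
(* The expected number of times outside [H] is at most [m * eta]. *)
- rewrite /f; under eq_integral do rewrite EFinD.
  rewrite ge0_integralD//=; last 2 first.
  - by move=> x _; rewrite lee_fin mulr_ge0// orbit_sum_ge0.
  - exact/measurable_EFinP.
  rewrite integral_cst//= (@probability_setT _ _ _ mu) mule1.
  under [X in (_ + X)%E]eq_integral do rewrite EFinM.
  rewrite ge0_integralZl_EFin//=; last 2 first.
  - by move=> x _; rewrite lee_fin orbit_sum_ge0.
  - by apply/measurable_EFinP; exact: measurable_orbit_sum.
  rewrite integral_orbit_sum// integral_indic ?setIT//; last exact: measurableC.
  apply: (@le_trans _ _ (a%:E + D%:E * (m%:R%:E * eta%:E))%E).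
    rewrite leeD2l// lee_wpmul2l ?lee_fin// lee_wpmul2l ?lee_fin//.
    exact: measure_setC_le.
  rewrite -!EFinM -EFinD lee_fin /a natrD.
  by move: budget; rewrite mulrDr [eta * _]mulrC; lra.
- have [w [wW _ _]] := HWf x0.
  have sz0 : (0 < size (code_cat W Wq))%N by case: (code_cat W Wq) wW.
  have s0 : 0 < (size s)%:R :> R.
    by have [y + _] := Hs x0; rewrite ltr0n; case: (s).
  rewrite lee_fin ler_wpM2l ?invr_ge0// -ler_expR lnK ?posrE ?ltr0n//.
  rewrite expRD expRM_natl lnK ?posrE//.
  by rewrite size_allpairs sWq natrM natrX; apply: ler_pM.
Qed.

(** The sets [A n] covered by few average balls are fed to [ergodic_tiling], for
    which a positive measure is enough: the tiles cover almost all times, however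
    small [1 - delta] is. This is why the bound holds at the distortion [eps]
    itself, without a term for the uncovered part. *)
Lemma rate_distortion_le_avg_entropy (eps delta D : R) :
  (forall x y : X, mdist x y <= D) -> 0 < D -> 0 < eps -> delta < 1 ->
  (rate_distortion T mu eps <= avg_entropy T mu eps delta)%E.
Proof.
move=> mD D0 eps0 d1.
apply: lee_lt_real => [|t]; first exact: avg_entropy_ge0.
have := avg_entropy_ge0 eps d1.
case hE : (avg_entropy T mu eps delta) => [h| |]//.
rewrite lee_fin lte_fin => h0 ht.
pose c := h + (t - h) / 3; pose c' := c + (t - h) / 3.
have [hc cc' c't] : [/\ h < c, c < c' & c' < t] by rewrite /c' /c; split; lra.
have c'0 : 0 < c' by exact: le_lt_trans h0 (lt_trans hc cc').
have [n1 Hn1] : exists N, forall n, (N <= n)%N -> exists s : seq X,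
    (size s)%:R <= expR (c * n%:R) /\
    exists A, [/\ measurable A, ((1 - delta)%:E < mu A)%E &
      A `<=` \bigcup_(x in [set` s]) avg_ball T n eps x].
  by apply: avg_entropy_lt_cover => //; rewrite hE lte_fin.
have /choice[sA HsA] n : exists sA : seq X * set X,
    [/\ measurable sA.2, (n1 <= n)%N -> ((1 - delta)%:E < mu sA.2)%E,
      sA.2 `<=` \bigcup_(x in [set` sA.1]) avg_ball T n eps x
    & (n1 <= n)%N -> (size sA.1)%:R <= expR (c * n%:R)].
  have [nn1|n1n] := leqP n1 n.
    by have [s [ss [A [mA muA As]]]] := Hn1 n nn1; exists (s, A); split.
  by exists ([::], set0); split => //=; rewrite leqNgt n1n.
pose A n := (sA n).2.
have mA n : measurable (A n) by have [] := HsA n.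
have A0 : (0 < mu (lim_sup_set A))%E.
  apply: (@lt_le_trans _ _ (1 - delta)%:E); first by rewrite lte_fin subr_gt0.
  apply: lim_sup_set_measure_ge => // N; exists (maxn N n1); first exact: leq_maxl.
  by have [_ H _ _] := HsA (maxn N n1); rewrite ltW// H// leq_maxr.
have [s Hs] : exists s : seq X, forall x, exists2 y, y \in s & mdist x y < eps / 2.
  by apply: compact_net => //; rewrite divr_gt0.
pose l := ln (size s)%:R : R.
have l0 : 0 <= l.
  by have [y ys _] := Hs x0; rewrite /l ln_ge0// ler1n; case: (s) ys.
have tc : 0 < t - c' by rewrite subr_gt0.
have l1 : 0 < l + 1 by rewrite ltr_wpDl.
(* The padding has length about [m * (t - c') / (2 * (l + 1))], so that its rate
   uses about half of the margin [t - c']; it saves [eps / 2] per symbol, and [eta] is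
   such that this is exactly the excess [3 * D * eta * m]. *)
pose eta := eps * (t - c') / (12 * D * (l + 1)).
have eta0 : 0 < eta by rewrite divr_gt0 ?mulr_gt0.
have mT : measurable_fun setT T by exact: continuous_borel.
have [J HJ] := ergodic_tiling mT mu_inv mu_erg mA A0 eta0.
have [n2 Hn2] := transition_budget J cc' c'0.
have [n3 Hn3] := nat_ge (J%:R / eta).
pose N0 := (n1 + n2 + n3).+1.
have n1N : (n1 <= N0)%N by rewrite /N0 -addnA -addnS leq_addr.
have n2N : (n2 <= N0)%N by rewrite /N0 -addnS addnAC leq_addl.
have n3N : (n3 <= N0)%N by rewrite /N0 -addSn leq_addl.
have JN0 : J%:R <= eta * N0%:R by rewrite mulrC -ler_pdivrMr// Hn3.
have [N1] := HJ N0; set H := tile_set _ _ _ _ _ => muH.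
have mH : measurable H by exact: measurable_tile_set.
have [n4 Hn4] := nat_ge ((N1 + J)%:R / eta).
have [n5 Hn5] := nat_ge (2 * l / (t - c')).
pose m := (n4 + n5).+1.
have n4m : (n4 <= m)%N by rewrite /m -addnS leq_addr.
have n5m : (n5 <= m)%N by rewrite /m -addSn leq_addl.
have mN1 : (N1 + J)%:R <= eta * m%:R by rewrite mulrC -ler_pdivrMr// Hn4.
have ml : 2 * l <= m%:R * (t - c') by rewrite -ler_pdivrMr// Hn5.
pose V n := [seq traject T x n | x <- (sA n).1].
have [||W sW HW] := @tiling_code R X T x0 A V c c' D eps eta J N0 N1 mD (ltW c'0)
  (ltW D0) (ltW eps0) (ltW eta0) isT JN0 _ _ (Hn2 _ _ n2N) m.
- by move=> n y An; apply: avg_ball_codes; have [_ _ + _] := HsA n; exact.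
- move=> n Nn; rewrite size_map; have [_ _ _] := HsA n; apply.
  exact: leq_trans Nn.
pose b := eta * m%:R + (N1 + J)%:R.
have b0 : 0 <= b by rewrite addr_ge0// mulr_ge0// ltW.
pose qr := m%:R * (t - c') / (2 * (l + 1)).
have qr0 : 0 <= qr by rewrite divr_ge0 ?mulr_ge0 ?ltW.
pose q := (Num.truncn qr).+1.
have qlo : qr <= q%:R by rewrite ltW// truncnS_gt.
have qhi : q%:R <= qr + 1 by rewrite -natr1 lerD2r truncn_le.
have HW' x : codes T x0 W m x (m%:R * eps + D * (orbit_sum T \1_(~` H) m x + b)).
  by have := HW x; rewrite -addrA.
have m0 : (0 < m)%N by [].
apply: (le_trans (rate_distortion_le_padded_code (q := q) m0 eps0 (ltW D0) b0
  mH muH sW HW' Hs _)); last first.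
  rewrite lee_fin ler_pdivrMl ?ltr0n// natrD.
  by apply: padded_rate_le qhi ml => //; exact: ltW (lt_trans c'0 c't).
apply: (@le_trans _ _ (qr * (eps / 2))); last by rewrite ler_wpM2r// divr_ge0// ltW.
apply: (@le_trans _ _ (D * (3 * (eta * m%:R)))).
  by rewrite ler_wpM2l ?(ltW D0)// addrA -mulr2n mulr_natl [leRHS]mulrSr lerD2l.
rewrite le_eqVlt; apply/orP; left; apply/eqP; rewrite /eta /qr.
by field; rewrite !gt_eqF.
Qed.

End upper_bound.

(** * Product measures and greedy covers *)

Section finite_products.
Context (R : realType).

Lemma expR_le_quadratic (y : R) : y <= 2^-1 -> expR y <= 1 + y + 2 * y ^+ 2.
Proof.
move=> y2; have y1 : 0 < 1 - y by lra.
have : 1 - y <= expR (- y) by exact: expR_ge1Dx.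
rewrite -(ler_pM2r (expR_gt0 y)) -expRD addNr expR0 => H.
rewrite -(ler_pM2l y1); apply: (le_trans H).
have : 0 <= y ^+ 2 * (1 - 2 * y) by rewrite mulr_ge0 ?sqr_ge0//; lra.
rewrite expr2; nra.
Qed.

Lemma sum_ffun_prod (I J : finType) (F : I -> J -> R) :
  \sum_(v : {ffun I -> J}) \prod_i F i (v i) = \prod_i \sum_j F i j.
Proof. by rewrite bigA_distr_bigA. Qed.

Lemma sum_ffun_prod1 (I J : finType) (w : I -> J -> R) :
  (forall i, \sum_j w i j = 1) ->
  \sum_(v : {ffun I -> J}) \prod_i w i (v i) = 1.
Proof. by move=> w1; rewrite sum_ffun_prod big1. Qed.

(** Each summand depends on one coordinate; the other coordinates integrate to 1. *)
Lemma product_mean (I J : finType) (w Z : I -> J -> R) :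
  (forall i, \sum_j w i j = 1) ->
  \sum_(v : {ffun I -> J}) (\prod_i w i (v i)) * \sum_i Z i (v i) =
  \sum_i \sum_j w i j * Z i j.
Proof.
move=> w1; under eq_bigr do rewrite mulr_sumr.
rewrite exchange_big/=; apply: eq_bigr => i _.
transitivity (\sum_(v : {ffun I -> J})
    \prod_i' (w i' (v i') * (if i' == i then Z i (v i') else 1))).
  apply: eq_bigr => v _; rewrite big_split/=; congr (_ * _).
  by rewrite -big_mkcond/= big_pred1_eq.
rewrite (sum_ffun_prod (fun i' j => w i' j * (if i' == i then Z i j else 1))).
rewrite (bigD1 i)//= [X in _ * X]big1 ?mulr1.
  by apply: eq_bigr => j _; rewrite eqxx.
move=> i' /negbTE i'i; rewrite -[RHS](w1 i'); apply: eq_bigr => j _.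
by rewrite i'i mulr1.
Qed.

(** An exponential deviation bound for sums of independent bounded variables, with
    a rate [rho] that depends on the bound and on the deviation only. The moment
    generating function factorizes, and each factor is controlled by
    [expR_le_quadratic] with a small parameter [t]. *)
Lemma product_concentration (C kappa : R) : 0 < kappa ->
  exists2 rho, 0 < rho & forall (K : nat) (J : finType) (w Z : 'I_K -> J -> R),
    (forall i j, 0 <= w i j) -> (forall i, \sum_j w i j = 1) ->
    (forall i j, `|Z i j| <= C) ->
    \sum_(v : {ffun 'I_K -> J} |
          \sum_i \sum_j w i j * Z i j + K%:R * kappa <= \sum_i Z i (v i))
      \prod_i w i (v i) <= expR (- (K%:R * rho)).
Proof.
move=> kappa0.
pose C' := `|C| + 1.
have C'0 : 0 < C' by rewrite ltr_wpDl.
pose t := Num.min (2^-1 / C') (kappa / (4 * C' ^+ 2)).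
have t0 : 0 < t by rewrite lt_min !divr_gt0// mulr_gt0// exprn_gt0.
exists (t * kappa / 2); first by rewrite divr_gt0// mulr_gt0.
move=> K J w Z w0 w1 ZC.
have tC : t * C' <= 2^-1 by rewrite -ler_pdivlMr// ge_min lexx.
have tC2 : 2 * (t * C') ^+ 2 <= t * kappa / 2.
  have : t <= kappa / (4 * C' ^+ 2) by rewrite ge_min lexx orbT.
  rewrite ler_pdivlMr ?mulr_gt0 ?exprn_gt0// => H.
  have := ler_wpM2l (ltW t0) H; rewrite exprMn; nra.
pose m := \sum_i \sum_j w i j * Z i j.
have mgf i : \sum_j w i j * expR (t * Z i j) <=
    expR (t * \sum_j w i j * Z i j + t * kappa / 2).
  apply: le_trans (expR_ge1Dx _).
  apply: (@le_trans _ _ (\sum_j w i j * (1 + t * Z i j + t * kappa / 2))).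
    apply: ler_sum => j _; rewrite ler_wpM2l//.
    have ZC' : `|t * Z i j| <= t * C'.
      rewrite normrM gtr0_norm// ler_wpM2l ?(ltW t0)//.
      by rewrite (le_trans (ZC i j))// /C' (le_trans (ler_norm C))// lerDl.
    apply: le_trans (expR_le_quadratic _) _.
      by rewrite (le_trans (ler_norm _))// (le_trans ZC').
    rewrite lerD2l (le_trans _ tC2)// ler_wpM2l//.
    by rewrite -[leLHS]real_normK ?num_real// ler_sqr ?nnegrE ?(le_trans _ ZC').
  under eq_bigr do rewrite !mulrDr mulr1.
  rewrite !big_split/= w1 -mulr_suml w1 mul1r addrA lerD2r lerD2l mulr_sumr.
  by apply: ler_sum => j _; rewrite mulrCA.
apply: (@le_trans _ _ (\sum_(v : {ffun 'I_K -> J}) expR (- (t * (m + K%:R * kappa))) *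
    \prod_i (w i (v i) * expR (t * Z i (v i))))).
  rewrite [leRHS](bigID (fun v : {ffun 'I_K -> J} => m + K%:R * kappa <= \sum_i Z i (v i)))/=.
  rewrite -[leLHS]addr0; apply: lerD; last first.
    apply: sumr_ge0 => v _; rewrite mulr_ge0 ?expR_ge0// prodr_ge0// => i _.
    by rewrite mulr_ge0// expR_ge0.
  apply: ler_sum => v Hv; rewrite big_split/= mulrCA ler_peMr ?prodr_ge0//.
  rewrite -expR_sum -expRD -[leLHS]expR0 ler_expR -mulr_sumr addrC subr_ge0.
  exact: (ler_wpM2l (ltW t0) Hv).
rewrite -mulr_sumr (sum_ffun_prod (fun i j => w i j * expR (t * Z i j))).
apply: (@le_trans _ _ (expR (- (t * (m + K%:R * kappa))) *
    \prod_i expR (t * (\sum_j w i j * Z i j) + t * kappa / 2))).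
  rewrite ler_wpM2l ?expR_ge0//; apply: ler_prod => i _.
  by rewrite mgf sumr_ge0// => j _; rewrite mulr_ge0// expR_ge0.
rewrite -expR_sum -expRD ler_expR big_split/= -mulr_sumr -/m sumr_const card_ord.
rewrite -[_ *+ K]mulr_natl; lra.
Qed.

End finite_products.

Section greedy_cover.
Context d (X : measurableType d) (R : realType) (mu : probability X R).

(** If a random [v] catches each point of [G] with probability at least [p], then
    on average it catches the proportion [p] of [G], hence some [v] does. *)
Lemma exists_large_section (V : finType) (pi : V -> R) (B : V -> set X)
    (G : set X) (p : R) :
  (forall v, 0 <= pi v) -> \sum_v pi v <= 1 -> (forall v, measurable (B v)) ->
  measurable G -> 0 < p ->
  (forall x, G x -> p <= \sum_(v | `[< B v x >]) pi v) -> (0 < mu G)%E ->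
  exists v, (p%:E * mu G <= mu (G `&` B v))%E.
Proof.
move=> pi0 pi1 mB mG p0 Hp muG; apply: contrapT => /forallNP H.
have mGB v : measurable (G `&` B v) by exact: measurableI.
pose g v := fine (mu (G `&` B v)).
have gE v : mu (G `&` B v) = (g v)%:E by rewrite fineK// fin_num_measure.
pose G' := fine (mu G).
have G'E : mu G = G'%:E by rewrite fineK// fin_num_measure.
have lt v : g v < p * G'.
  by have /negP := H v; rewrite -ltNge gE G'E -EFinM lte_fin.
have avg : p * G' <= \sum_v pi v * g v.
  rewrite -lee_fin EFinM -G'E -sumEFin.
  under eq_bigr do rewrite EFinM -gE.
  have -> : (p%:E * mu G = \int[mu]_x (p * \1_G x)%:E)%E.
    under eq_integral do rewrite EFinM.
    rewrite ge0_integralZl_EFin//= ?integral_indic ?setIT ?ltW//.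
    by apply/measurable_EFinP; apply: measurable_indic.
  have -> : (\sum_v (pi v)%:E * mu (G `&` B v) =
      \int[mu]_x (\sum_v (pi v * \1_(G `&` B v) x)%:E))%E.
    rewrite ge0_integral_sum//=; last 2 first.
    - move=> v; apply/measurable_EFinP/measurable_funM => //.
    - by move=> v x _; rewrite lee_fin mulr_ge0.
    apply: eq_bigr => v _; under eq_integral do rewrite EFinM.
    rewrite ge0_integralZl_EFin//= ?integral_indic ?setIT//.
    by apply/measurable_EFinP; apply: measurable_indic.
  apply: ge0_le_integral => //=.
  - by move=> x _; rewrite lee_fin mulr_ge0 ?(ltW p0).
  - by apply/measurable_EFinP/measurable_funM => //; exact: measurable_indic.
  - by apply: emeasurable_sum => v; apply/measurable_EFinP/measurable_funM => //.
  - move=> x _; rewrite sumEFin lee_fin.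
    have [Gx|nGx] := pselect (G x); last first.
      by rewrite indicE memNset// mulr0 sumr_ge0// => v _; rewrite mulr_ge0.
    rewrite indicE mem_set// mulr1 (le_trans (Hp x Gx))// big_mkcond/=.
    apply: ler_sum => v _; case: asboolP => Bv; last by rewrite mulr_ge0.
    by rewrite indicE mem_set ?mulr1.
have pG : 0 <= p * G' by rewrite mulr_ge0 ?fine_ge0// ltW.
have z v : pi v * (p * G' - g v) = 0.
  have H0 : \sum_v pi v * (p * G' - g v) = 0.
    apply/eqP; rewrite eq_le sumr_ge0 ?andbT; last first.
      by move=> u _; rewrite mulr_ge0// subr_ge0 ltW.
    under eq_bigr do rewrite mulrBr; rewrite sumrB subr_le0 -mulr_suml.
    by apply: le_trans avg; rewrite -[leRHS]mul1r ler_wpM2r.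
  move: H0 => /psumr_eq0P; apply => // u _.
  by rewrite mulr_ge0// subr_ge0 ltW.
have [x Gx] : exists x, G x.
  apply: contrapT => /forallNP nG; move: muG; rewrite (_ : G = set0) ?measure0 ?ltxx//.
  by rewrite -subset0.
have := Hp x Gx; rewrite big1 ?leNgt ?p0// => v _.
by have := z v; move/eqP; rewrite mulf_eq0 subr_eq0 (gt_eqF (lt v)) orbF => /eqP.
Qed.

(** Choosing [v] greedily multiplies the uncovered measure by at most
    [1 - p <= expR (- p)] at each step. *)
Lemma greedy_cover (V : finType) (pi : V -> R) (B : V -> set X)
    (G : set X) (p : R) :
  (forall v, 0 <= pi v) -> \sum_v pi v <= 1 -> (forall v, measurable (B v)) ->
  measurable G -> 0 < p ->
  (forall x, G x -> p <= \sum_(v | `[< B v x >]) pi v) ->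
  forall N, exists2 s : seq V, (size s <= N)%N &
    (mu (G `\` \bigcup_(v in [set` s]) B v) <= (expR (- (p * N%:R)))%:E)%E.
Proof.
move=> pi0 pi1 mB mG p0 Hp; elim=> [|N [s sN IH]].
  exists [::] => //; rewrite mulr0 oppr0 expR0 probability_le1//.
  by apply: measurableD => //; apply: fin_bigcup_measurable.
set G' := G `\` _ in IH.
have mG' : measurable G' by apply: measurableD => //; exact: fin_bigcup_measurable.
have [G0|G0] := eqVneq (mu G') 0%E.
  by exists s; [exact: leqW|rewrite -/G' G0 lee_fin expR_ge0].
have muG' : (0 < mu G')%E by rewrite lt0e G0 measure_ge0.
have [v Hv] := exists_large_section pi0 pi1 mB mG' p0 (fun x Gx => Hp x Gx.1) muG'.
exists (v :: s) => //.
have -> : G `\` \bigcup_(u in [set` v :: s]) B u = G' `\` (G' `&` B v).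
  rewrite setDIr setDv set0U /G' setDDl; congr (_ `\` _).
  apply/seteqP; split => x.
    by move=> [u /=]; rewrite inE => /predU1P[->|us] Bu; [right|left; exists u].
  move=> [[u us Bu]|Bv]; first by exists u => //=; rewrite inE us orbT.
  by exists v => //=; rewrite mem_head.
have mGB : measurable (G' `&` B v) by exact: measurableI.
have -> : mu (G' `\` (G' `&` B v)) = (mu G' - mu (G' `&` B v))%E.
  rewrite measureD; [by rewrite setIA setIid|exact: mG'|exact: mGB|].
  by rewrite (le_lt_trans (probability_le1 mu mG'))// ltry.
move: Hv IH; rewrite -(fineK (fin_num_measure mu _ mG')) -(fineK (fin_num_measure mu _ mGB)).
rewrite -EFinM -EFinB !lee_fin => Hv IH.
apply: (@le_trans _ _ ((1 - p) * fine (mu G'))); first lra.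
rewrite -natr1 mulrDr opprD expRD mulrC mulr1.
have : 1 - p <= expR (- p) by exact: expR_ge1Dx.
move=> H; apply: (@le_trans _ _ (fine (mu G') * expR (- p))).
  by rewrite ler_wpM2l// fine_ge0.
by rewrite ler_wpM2r// expR_ge0.
Qed.

End greedy_cover.

(** * Random code words over a finite channel *)

Lemma sum_blocks (R : realType) (F : nat -> R) k n :
  \sum_(i < k * n) F i = \sum_(j < k) \sum_(t < n) F (j * n + t)%N.
Proof.
elim: k => [|k IH]; first by rewrite mul0n !big_ord0.
rewrite mulSnr big_split_ord/= big_ord_recr/= IH; congr (_ + _).
Qed.

Section block_code.
Context (R : realType) (A U : finType) (n k : nat).
Implicit Types (a : nat -> A) (phi w : A -> U -> R).

(** A random offset in ['I_n], then [k] letters of the output alphabet, placed at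
    the times congruent to the offset modulo [n]. Since the map iterated [n] times
    need not be ergodic, averages along a single residue class are not controlled;
    averaging over the offset turns them into averages along the whole orbit. *)
Definition block_word := ('I_n * {ffun 'I_k -> U})%type.

Definition block_sum phi a (z : block_word) : R :=
  \sum_(j < k) phi (a (j * n + z.1)%N) (z.2 j).

(** The probability of a block word when its letters are drawn from [w], given the
    input letters [a i]. *)
Definition block_weight w a (z : block_word) : R :=
  n%:R^-1 * \prod_(j < k) w (a (j * n + z.1)%N) (z.2 j).

Lemma block_weight_ge0 w a z : (forall x u, 0 <= w x u) -> 0 <= block_weight w a z.
Proof. by move=> w0; rewrite mulr_ge0 ?invr_ge0// prodr_ge0. Qed.

Lemma sum_block_weight w a : (0 < n)%N -> (forall x, \sum_u w x u = 1) ->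
  \sum_z block_weight w a z = 1.
Proof.
move=> n0 w1; rewrite -(pair_bigA _ (fun s u => block_weight w a (s, u)))/=.
transitivity (\sum_(s < n) (n%:R^-1 : R)).
  apply: eq_bigr => s _; rewrite -mulr_sumr.
  by rewrite (sum_ffun_prod1 (w := fun (j : 'I_k) u => w (a (j * n + s)%N) u))// mulr1.
by rewrite sumr_const card_ord -[RHS](@mulVf _ n%:R) ?mulr_natr ?pnatr_eq0 -?lt0n.
Qed.

(** The offset and the index of the letter together enumerate [k * n] consecutive
    times, each exactly once. *)
Lemma block_mean w phi a : (forall x, \sum_u w x u = 1) ->
  \sum_z block_weight w a z * block_sum phi a z =
  n%:R^-1 * \sum_(i < k * n) \sum_u w (a i) u * phi (a i) u.
Proof.
move=> w1; rewrite -(pair_bigA _ (fun s u => block_weight w a (s, u) * block_sum phi a (s, u)))/=.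
rewrite (sum_blocks (fun i => \sum_u w (a i) u * phi (a i) u)).
rewrite [in RHS]exchange_big/= [RHS]mulr_sumr.
apply: eq_bigr => s _.
under eq_bigr do rewrite /block_weight /block_sum/= -mulrA.
rewrite -mulr_sumr; congr (_ * _).
exact: (@product_mean _ _ _ (fun (j : 'I_k) u => w (a (j * n + s)%N) u)
  (fun j u => phi (a (j * n + s)%N) u)).
Qed.

Lemma block_sum_bound phi a z B : (forall x u, `|phi x u| <= B) ->
  `|block_sum phi a z| <= k%:R * B.
Proof.
move=> H; apply: (le_trans (ler_norm_sum _ _ _)).
apply: (@le_trans _ _ (\sum_(j < k) B)); first exact: ler_sum.
by rewrite sumr_const card_ord mulr_natl.
Qed.

(** One block word on each of [K] superblocks of length [k.+1 * n]; the extra [n]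
    times leave room for the offset. *)
Definition code_word K := {ffun 'I_K -> block_word}.

Definition code_sum K phi a (v : code_word K) : R :=
  \sum_(r < K) block_sum phi (fun i => a (r * (k.+1 * n) + i)%N) (v r).

Context (W : A -> U -> R) (q : U -> R).

Definition log_ratio (x : A) u : R := ln (W x u / q u).

(** The law of a random code word: letters are drawn from the output law [q],
    independently of the input. *)
Definition code_weight K (v : code_word K) : R :=
  \prod_(r < K) (n%:R^-1 * \prod_(j < k) q ((v r).2 j)).

Context (W0 : forall x u, 0 <= W x u) (W1 : forall x, \sum_u W x u = 1)
  (q0 : forall u, 0 <= q u) (q1 : \sum_u q u = 1)
  (Wq : forall x u, 0 < W x u -> 0 < q u).

(** Gibbs' inequality. *)
Lemma divergence_ge0 x : 0 <= \sum_u W x u * log_ratio x u.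
Proof.
suff : \sum_u (W x u - q u) <= \sum_u W x u * log_ratio x u.
  by rewrite sumrB W1 q1 subrr.
apply: ler_sum => u _; rewrite /log_ratio.
have := W0 x u; rewrite le_eqVlt => /predU1P[<-|Wp].
  by rewrite mul0r sub0r oppr_le0.
have qp := Wq Wp.
have := @le_ln1Dx R (q u / W x u - 1).
rewrite addrCA subrr addr0 => H.
have {H} : ln (q u / W x u) <= q u / W x u - 1 by apply: H; rewrite ltrBrDr addNr divr_gt0.
move=> /(ler_wpM2l (W0 x u)); rewrite mulrBr mulr1 [W x u * (_ / _)]mulrCA.
by rewrite mulfV ?gt_eqF// mulr1 !ln_div ?posrE// => H; lra.
Qed.

Lemma weight_change x u : W x u * expR (- log_ratio x u) <= q u.
Proof.
have := W0 x u; rewrite le_eqVlt => /predU1P[<-|Wp]; first by rewrite mul0r.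
have qp := Wq Wp.
rewrite expRN lnK ?posrE ?divr_gt0// invf_div mulrCA mulfV ?mulr1//.
by rewrite gt_eqF.
Qed.

(** The change of measure from the channel to the output law. The inequality,
    instead of an equality, absorbs the words of probability 0. *)
Lemma code_weight_change K a (v : code_word K) :
  (\prod_(r < K) block_weight W (fun i => a (r * (k.+1 * n) + i)%N) (v r)) *
    expR (- code_sum log_ratio a v) <= code_weight v.
Proof.
rewrite /code_sum -sumrN expR_sum -big_split/=; apply: ler_prod => r _.
rewrite mulr_ge0 ?expR_ge0 ?block_weight_ge0//=.
rewrite /block_weight -mulrA ler_wpM2l ?invr_ge0//.
rewrite /block_sum -sumrN expR_sum -big_split/=; apply: ler_prod => j _.
by rewrite mulr_ge0 ?expR_ge0//= weight_change.
Qed.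

Lemma code_weight_ge0 K (v : code_word K) : 0 <= code_weight v.
Proof. by apply: prodr_ge0 => r _; rewrite mulr_ge0 ?invr_ge0// prodr_ge0. Qed.

Lemma sum_code_weight K : (0 < n)%N -> \sum_(v : code_word K) code_weight v = 1.
Proof.
move=> n0; rewrite /code_weight (sum_ffun_prod1
  (w := fun (r : 'I_K) (z : block_word) => n%:R^-1 * \prod_(j < k) q (z.2 j)))// => r.
rewrite -(pair_bigA _ (fun (s : 'I_n) (u : {ffun 'I_k -> U}) =>
  n%:R^-1 * \prod_(j < k) q (u j)))/=.
transitivity (\sum_(s < n) (n%:R^-1 : R)).
  apply: eq_bigr => s _; rewrite -mulr_sumr.
  by rewrite (sum_ffun_prod1 (w := fun (j : 'I_k) u => q u))// mulr1.
by rewrite sumr_const card_ord -[RHS](@mulVf _ n%:R) ?mulr_natr ?pnatr_eq0 -?lt0n.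
Qed.

(** The times counted for the superblocks are distinct, and the other ones can be
    added because the conditional means are nonnegative. *)
Lemma code_mean_le K a phi (F : R) :
  (forall x, 0 <= \sum_u W x u * phi x u) ->
  \sum_(i < K * (k.+1 * n)) \sum_u W (a i) u * phi (a i) u <= F ->
  \sum_(r < K) \sum_z block_weight W (fun i => a (r * (k.+1 * n) + i)%N) z *
     block_sum phi (fun i => a (r * (k.+1 * n) + i)%N) z <= n%:R^-1 * F.
Proof.
move=> phi0; rewrite (sum_blocks (fun i => \sum_u W (a i) u * phi (a i) u)) => HF.
apply: (@le_trans _ _ (n%:R^-1 * \sum_(r < K) \sum_(t < k.+1 * n)
   \sum_u W (a (r * (k.+1 * n) + t)%N) u * phi (a (r * (k.+1 * n) + t)%N) u)); last first.
  by rewrite ler_wpM2l ?invr_ge0.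
rewrite mulr_sumr; apply: ler_sum => r _; rewrite block_mean// ler_wpM2l ?invr_ge0//.
by rewrite mulSnr big_split_ord/= lerDl sumr_ge0.
Qed.

(** The core of the coding theorem. Under the channel, the cost and the
    logarithmic likelihood ratio of a code word are sums over the superblocks of
    independent bounded terms, so with probability at least 1/2 neither
    exceeds its mean by more than [K * kappa], and the means are bounded by [F / n]
    and [G / n]. On that event the likelihood ratio bounds the cost of passing from
    the channel to the output law. *)
Lemma random_code_ball (c : A -> U -> R) (kappa : R) : (0 < n)%N -> 0 < kappa ->
  (forall x u, 0 <= c x u) ->
  exists K0, forall K, (K0 <= K)%N -> forall a (F G : R),
    \sum_(i < K * (k.+1 * n)) \sum_u W (a i) u * log_ratio (a i) u <= F ->
    \sum_(i < K * (k.+1 * n)) \sum_u W (a i) u * c (a i) u <= G ->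
    2^-1 * expR (- (n%:R^-1 * F + K%:R * kappa)) <=
    \sum_(v : code_word K | code_sum c a v <= n%:R^-1 * G + K%:R * kappa) code_weight v.
Proof.
move=> n0 kappa0 c0.
pose B (phi : A -> U -> R) := \sum_x \sum_u `|phi x u|.
have HB phi x u : `|phi x u| <= B phi.
  rewrite /B (bigD1 x)//= (bigD1 u)//= -addrA lerDl addr_ge0// ?sumr_ge0// => y _.
  exact: sumr_ge0.
have [rho1 rho10 H1] := @product_concentration R (k%:R * B log_ratio) kappa kappa0.
have [rho2 rho20 H2] := @product_concentration R (k%:R * B c) kappa kappa0.
have [n1 Hn1] := nat_ge (3 / rho1); have [n2 Hn2] := nat_ge (3 / rho2).
exists (n1 + n2)%N => K nK a F G HF HG.
have le4 rho : 0 < rho -> 3 / rho <= K%:R -> expR (- (K%:R * rho)) <= 4^-1.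
  move=> rho0; rewrite ler_pdivrMr// => H.
  rewrite expRN lef_pV2 ?posrE ?expR_gt0//.
  apply: le_trans (expR_ge1Dx _); lra.
pose a' (r : 'I_K) i := a (r * (k.+1 * n) + i)%N.
pose w (r : 'I_K) (z : block_word) := block_weight W (a' r) z.
have w0 r z : 0 <= w r z by exact: block_weight_ge0.
have w1 r : \sum_z w r z = 1 by exact: sum_block_weight.
pose Z1 (r : 'I_K) z := block_sum log_ratio (a' r) z.
pose Z2 (r : 'I_K) z := block_sum c (a' r) z.
have {}H1 := H1 K _ w Z1 w0 w1 (fun r z => block_sum_bound _ _ (HB _)).
have {}H2 := H2 K _ w Z2 w0 w1 (fun r z => block_sum_bound _ _ (HB _)).
have h1 : expR (- (K%:R * rho1)) <= 4^-1.
  by apply: le4 => //; apply: Hn1; apply: leq_trans nK; exact: leq_addr.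
have h2 : expR (- (K%:R * rho2)) <= 4^-1.
  by apply: le4 => //; apply: Hn2; apply: leq_trans nK; exact: leq_addl.
have m1 := code_mean_le divergence_ge0 HF.
have m2 := code_mean_le (fun x => sumr_ge0 _ (fun u _ => mulr_ge0 (W0 x u) (c0 x u))) HG.
pose b1 (v : code_word K) := \sum_r \sum_z w r z * Z1 r z + K%:R * kappa <= \sum_r Z1 r (v r).
pose b2 (v : code_word K) := \sum_r \sum_z w r z * Z2 r z + K%:R * kappa <= \sum_r Z2 r (v r).
pose p (v : code_word K) := \prod_r w r (v r).
have p0 v : 0 <= p v by exact: prodr_ge0.
have pgood : 2^-1 <= \sum_(v | ~~ b1 v && ~~ b2 v) p v.
  have tot : \sum_v p v = 1 by exact: sum_ffun_prod1.
  have : \sum_v p v <= \sum_(v | ~~ b1 v && ~~ b2 v) p v +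
      \sum_(v | b1 v) p v + \sum_(v | b2 v) p v.
    rewrite [X in _ <= X + _ + _]big_mkcond [X in _ <= _ + X + _]big_mkcond.
    rewrite [X in _ <= _ + X]big_mkcond/=.
    rewrite -!big_split/=; apply: ler_sum => v _.
    by case: (b1 v); case: (b2 v); rewrite /= ?add0r ?addr0 ?lerDl.
  have {}H1 := le_trans H1 h1; have {}H2 := le_trans H2 h2.
  by rewrite tot => /le_trans /(_ (lerD (lerD (lexx _) H1) H2)); lra.
apply: (@le_trans _ _ (\sum_(v | ~~ b1 v && ~~ b2 v) p v * expR (- (n%:R^-1 * F + K%:R * kappa)))).
  by rewrite -mulr_suml ler_wpM2r// expR_ge0.
rewrite big_mkcond [leRHS]big_mkcond/=; apply: ler_sum => v _.
case: ifPn => [/andP[/negbTE nb1 /negbTE nb2]|_]; last by case: ifP => // _; exact: code_weight_ge0.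
have l1 : code_sum log_ratio a v <= n%:R^-1 * F + K%:R * kappa.
  move/negbT: nb1; rewrite -ltNge => /ltW /le_trans; apply.
  by rewrite lerD2r.
have l2 : code_sum c a v <= n%:R^-1 * G + K%:R * kappa.
  move/negbT: nb2; rewrite -ltNge => /ltW /le_trans; apply.
  by rewrite lerD2r.
rewrite l2; apply: le_trans (code_weight_change a v).
by rewrite ler_wpM2l// ler_expR lerN2.
Qed.

End block_code.

(** * From a channel to a cover by average balls *)

Section sampled_sums.
Context (R : realType) (D : R).
Implicit Types h : nat -> R.

Lemma sum_le_const h m : (forall i, h i <= D) -> \sum_(i < m) h i <= m%:R * D.
Proof.
move=> hD; apply: (@le_trans _ _ (\sum_(i < m) D)); first exact: ler_sum.
by rewrite sumr_const card_ord mulr_natl.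
Qed.

Lemma sum_block_le h k n (s : 'I_n) : (forall i, h i <= D) ->
  \sum_(i < k.+1 * n) h i <=
  \sum_(j < k) \sum_(t < n) h (j * n + s + t)%N + n%:R * D.
Proof.
move=> hD.
have -> : (k.+1 * n = s + (k * n + (n - s)))%N.
  by rewrite addnCA subnKC ?mulSnr// ltnW.
rewrite big_split_ord/= [X in _ + X]big_split_ord/=.
rewrite (sum_blocks (fun i => h (s + i)%N)).
have -> : \sum_(j < k) \sum_(t < n) h (j * n + s + t)%N =
    \sum_(j < k) \sum_(t < n) h (s + (j * n + t))%N.
  by apply: eq_bigr => j _; apply: eq_bigr => t _; rewrite [(_ * _ + s)%N]addnC -addnA.
have h1 := sum_le_const s hD.
have h2 := @sum_le_const (fun i => h (s + (k * n + i))%N) (n - s) (fun i => hD _).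
have -> : (n%:R : R) = s%:R + (n - s)%:R by rewrite -natrD subnKC// ltnW.
rewrite mulrDl; lra.
Qed.

(** The times read by a code word are all times below [m] but [m - K * (k * n)] of
    them, at each of which the function is at most [D]. *)
Lemma sum_code_positions_le h K k n m (s : 'I_K -> 'I_n) : (forall i, h i <= D) ->
  (K * (k.+1 * n) <= m)%N ->
  \sum_(i < m) h i <=
  \sum_(r < K) \sum_(j < k) \sum_(t < n) h (r * (k.+1 * n) + (j * n + s r) + t)%N
    + (m%:R - (K * (k * n))%:R) * D.
Proof.
move=> hD Km.
have -> : \sum_(i < m) h i = \sum_(i < K * (k.+1 * n) + (m - K * (k.+1 * n))) h i.
  by rewrite subnKC.
rewrite big_split_ord/=.
rewrite (sum_blocks h).
have h1 : \sum_(r < K) \sum_(t < k.+1 * n) h (r * (k.+1 * n) + t)%N <=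
    \sum_(r < K) (\sum_(j < k) \sum_(t < n) h (r * (k.+1 * n) + (j * n + s r) + t)%N + n%:R * D).
  apply: ler_sum => r _.
  have := @sum_block_le (fun i => h (r * (k.+1 * n) + i)%N) k n (s r) (fun i => hD _).
  move=> /le_trans; apply; rewrite lerD2r.
  by apply: ler_sum => j _; apply: ler_sum => t _; rewrite addnA.
have h2 := @sum_le_const (fun i => h (K * (k.+1 * n) + i)%N) (m - K * (k.+1 * n)) (fun i => hD _).
rewrite big_split/= sumr_const card_ord -[_ *+ K]mulr_natl in h1.
rewrite natrB// in h2.
have e1 : (K * (k.+1 * n))%:R = (K * (k * n))%:R + K%:R * n%:R :> R.
  by rewrite mulSn addnC mulnDr natrD -natrM.
rewrite e1 in h2; lra.
Qed.

End sampled_sums.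

Lemma distance_budget (R : realType) (a1 a2 t u mk ms b1 me b2 : R) :
  a1 <= t -> a2 <= t -> t <= u + mk + mk -> b1 <= me -> b2 <= ms / 8 + ms / 8 ->
  mk <= ms / 16 -> 0 < ms -> a2 + a1 + b1 + b2 < ms + (2 * u + me).
Proof. lra. Qed.

(** The logarithm of the number of code words, with [N] the length covered by the
    [K] superblocks and [c] the probability bound of [random_code_ball]. *)
Lemma code_rate_budget (R : realType) (C : R) (n m N K : nat) (I kappa eta : R)
    (c := 2^-1 * expR (- (n%:R^-1 * (N%:R * (I + kappa)) + K%:R * kappa))) :
  0 <= C -> (0 < n)%N -> (N <= m)%N -> (K <= N)%N -> 0 <= I -> 0 < kappa ->
  kappa <= eta / 8 -> 0 < eta -> 2 * ln (2 * (C + 1)) <= m%:R * eta ->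
  ln (C / c + 1) <= (n%:R^-1 * I + eta) * m%:R.
Proof.
move=> C0 n0 Nm KN I0 /ltW kappa0 ke eta0 hC.
set E := n%:R^-1 * (N%:R * (I + kappa)) + K%:R * kappa in c *.
have nR0 : 0 < (n%:R : R) by rewrite ltr0n.
have n1 : n%:R^-1 <= 1 :> R by rewrite invf_le1// ler1n.
have E0 : 0 <= E by rewrite addr_ge0 ?mulr_ge0 ?invr_ge0 ?addr_ge0.
have C1 : 0 < C + 1 by rewrite ltr_wpDl.
have h0 : ln (C / c + 1) <= ln (2 * (C + 1)) + E.
  have c0 : 0 < c by rewrite mulr_gt0 ?expR_gt0.
  rewrite -ler_expR lnK; last by rewrite posrE ltr_wpDl// divr_ge0// ltW.
  rewrite expRD lnK ?posrE ?mulr_gt0//.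
  have -> : 2 * (C + 1) * expR E = (C + 1) / c by rewrite /c expRN invfM !invrK; ring.
  rewrite mulrDl lerD2l mul1r -[leLHS]invr1 lef_pV2 ?posrE//.
  rewrite /c mulr_ile1 ?expR_ge0 ?expR_le1 ?oppr_le0//.
  by rewrite invf_le1// ler1n.
have h1 : E <= m%:R * (n%:R^-1 * I) + m%:R * kappa + m%:R * kappa.
  apply: lerD; last by rewrite ler_wpM2r// ler_nat (leq_trans KN).
  apply: (@le_trans _ _ (n%:R^-1 * (m%:R * (I + kappa)))).
    by rewrite ler_wpM2l ?invr_ge0// ler_wpM2r ?addr_ge0// ler_nat.
  by rewrite mulrDr mulrDr mulrCA lerD2l ler_piMl ?mulr_ge0.
have h2 : m%:R * kappa <= m%:R * (eta / 8) by rewrite ler_wpM2l.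
have h3 : 0 <= m%:R * eta by rewrite mulr_ge0// ltW.
have -> : (n%:R^-1 * I + eta) * m%:R = m%:R * (n%:R^-1 * I) + m%:R * eta by ring.
move: hC h0 h1 h2 h3; clearbody E; lra.
Qed.

Section lower_bound_channel.
Context d (R : realType) (X : measurableMetricType d R) (T : X -> X)
  (mu : probability X R).
Context (x0 : X) (X_borel : @measurable d X = <<s @open X >>)
  (T_cont : continuous T)
  (mu_inv : invariant_measure T mu) (mu_erg : ergodic_measure T mu).
Context (D : R) (mD : forall x y : X, mdist x y <= D) (D0 : 0 < D).
Context (e : R) (p : nat) (cc : 'I_p -> X) (g : X -> 'I_p)
  (mg : measurable_label g) (gE : forall x, mdist x (cc (g x)) < e).
Context (n : nat).

(** The cells visited during [n] steps: the input and the output alphabets both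
    consist of the sequences of [n] cells. *)
Definition block_label (x : X) := [ffun t : 'I_n => g (iter t T x)].

Definition block_dist (a u : {ffun 'I_n -> 'I_p}) : R :=
  \sum_t mdist (cc (a t)) (cc (u t)).

Lemma block_dist_ge0 a u : 0 <= block_dist a u.
Proof. by apply: sumr_ge0 => t _; exact: mdist_ge0. Qed.

Let mT : measurable_fun setT T := continuous_borel X_borel T_cont.

Lemma measurable_block_label : measurable_label block_label.
Proof.
apply: measurable_label_ffun => t.
exact: measurable_label_precomp (measurable_iter mT t) mg.
Qed.

(** Two orbits described by the same code word are close: at each time read by the
    word one passes through the centres of the two cells and of the letter. This
    is where the radius doubles, because a ball must be centred at an orbit. *)
Lemma orbit_dist_le k K m (v : code_word {ffun 'I_n -> 'I_p} n k K) x y :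
  (K * (k.+1 * n) <= m)%N ->
  \sum_(i < m) mdist (iter i T x) (iter i T y) <=
  code_sum block_dist (fun i => block_label (iter i T x)) v +
  code_sum block_dist (fun i => block_label (iter i T y)) v +
  (K * (k * n))%:R * (2 * e) + (m%:R - (K * (k * n))%:R) * D.
Proof.
move=> Km; apply: (le_trans (sum_code_positions_le
  (h := fun i => mdist (iter i T x) (iter i T y)) (fun r => (v r).1) (fun i => mD _ _) Km)).
rewrite lerD2r.
have -> : (K * (k * n))%:R * (2 * e) = \sum_(r < K) \sum_(j < k) \sum_(t < n) (2 * e).
  rewrite !sumr_const !card_ord -!mulrnA mulr_natl; congr (_ *+ _).
  by rewrite mulnA mulnC [(K * k)%N]mulnC.
rewrite /code_sum /block_sum -!big_split/=; apply: ler_sum => r _.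
rewrite -!big_split/=; apply: ler_sum => j _.
rewrite /block_dist -!big_split/=; apply: ler_sum => t _.
rewrite !ffunE [(_ + t)%N]addnC ![iter (t + _) _ _]iterD.
set x' := iter t T _; set y' := iter t T (iter _ T y).
set w := cc ((v r).2 j t).
have := gE x'; have := gE y'.
have := metric_triangle x' (cc (g x')) y'.
have := metric_triangle (cc (g x')) w y'.
have := metric_triangle w (cc (g y')) y'.
rewrite (metric_sym w (cc (g y'))) (metric_sym (cc (g y')) y').
lra.
Qed.

Context (W : {ffun 'I_n -> 'I_p} -> {ffun 'I_n -> 'I_p} -> R) (q : {ffun 'I_n -> 'I_p} -> R).
Context (W0 : forall x u, 0 <= W x u) (W1 : forall x, \sum_u W x u = 1)
  (q0 : forall u, 0 <= q u) (q1 : \sum_u q u = 1)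
  (Wq : forall x u, 0 < W x u -> 0 < q u).

Lemma measurable_fun_block_label (f : {ffun 'I_n -> 'I_p} -> R) :
  measurable_fun setT (f \o block_label).
Proof. exact: measurable_fun_label measurable_block_label. Qed.

Lemma measurable_code_ball k K (v : code_word {ffun 'I_n -> 'I_p} n k K) (tau : R) :
  measurable [set x | code_sum block_dist (fun i => block_label (iter i T x)) v <= tau].
Proof.
have mf : measurable_fun setT
    (fun x => code_sum block_dist (fun i => block_label (iter i T x)) v).
  apply: measurable_sum => r; apply: measurable_sum => j.
  apply: (measurableT_comp (measurable_fun_block_label (fun a => block_dist a _))).
  exact: measurable_iter.
have := mf measurableT _ (measurable_itv `]-oo, tau]).
by rewrite setTI; congr measurable; apply/seteqP; split => x /=; rewrite in_itv.
Qed.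

Lemma measurable_orbit_sum_gt (f : X -> R) (b : R) m : measurable_fun setT f ->
  measurable [set x | b < orbit_sum T f m x].
Proof.
move=> mf; have := measurable_orbit_sum mT m mf measurableT (measurable_itv `]b, +oo[).
by rewrite setTI; congr measurable; apply/seteqP; split => x /=; rewrite in_itv/= andbT.
Qed.

(** From a random code to a cover. Greedily chosen code words leave measure at
    most [delta / 4] of [E] uncovered as soon as their number is at least
    [ln (4 / delta) / c]; any point caught by a code word then serves as the
    centre of a ball. *)
Lemma avg_cover_number_le_code (V : finType) (pi : V -> R) (B : V -> set X) (E : set X)
    (m : nat) (c rho delta : R) :
  (forall v, 0 <= pi v) -> \sum_v pi v <= 1 -> (forall v, measurable (B v)) ->
  measurable E -> 0 < c -> 0 < delta -> (mu (~` E) <= (delta / 2)%:E)%E ->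
  (forall x, E x -> c <= \sum_(v | `[< B v x >]) pi v) ->
  (forall v x y, B v x -> B v y -> avg_dist T m x y < rho) ->
  (avg_cover_number T mu m rho delta <= (`|ln (4 / delta)| / c + 1)%:E)%E.
Proof.
move=> pi0 pi1 mB mE c0 delta0 muE Ec Bdist.
set C := `|ln (4 / delta)|.
have C0 : 0 <= C by exact: normr_ge0.
pose N := (Num.truncn (C / c)).+1.
have [s sN Hs] := @greedy_cover _ X R mu V pi B E c pi0 pi1 mB mE c0 Ec N.
set U := \bigcup_(v in [set` s]) B v in Hs.
have mU : measurable U by exact: fin_bigcup_measurable.
have mS : measurable (E `&` U) by exact: measurableI.
have mQ : measurable (E `\` U) by exact: measurableD.
have muQ : expR (- (c * N%:R)) <= delta / 4.
  rewrite -[leRHS]lnK ?posrE ?divr_gt0// ler_expR lerNl -lnV ?posrE ?divr_gt0// invf_div.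
  apply: (le_trans (ler_norm _)); rewrite -/C mulrC -ler_pdivrMr//.
  by rewrite ltW// truncnS_gt.
have muS : ((1 - delta)%:E < mu (E `&` U))%E.
  have fE A : measurable A -> exists r : R, mu A = r%:E.
    by move=> mA; exists (fine (mu A)); rewrite fineK// fin_num_measure.
  have [rE EE] := fE _ mE; have [rS ES] := fE _ mS; have [rQ EQ] := fE _ mQ.
  have H1 : (rE%:E = rQ%:E + rS%:E)%E by rewrite -EE -ES -EQ; exact: measureDI.
  move: H1 muE Hs; rewrite probability_setC// EE EQ ES -EFinB -EFinD => -[->].
  rewrite !lee_fin lte_fin => h1 /le_trans/(_ muQ) h2.
  lra.
pose ctr v := xget x0 (B v).
apply: (@le_trans _ _ (size (map ctr s))%:R%:E).
  apply: ereal_inf_lbound; exists (map ctr s) => //; exists (E `&` U); split => //.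
  move=> x [_ [v /= vs Bvx]]; exists (ctr v); first by apply: map_f.
  by apply: (Bdist v) => //; apply: xgetPex; exists x.
rewrite size_map lee_fin; apply: (@le_trans _ _ N%:R); first by rewrite ler_nat.
by rewrite -natr1 lerD2r truncn_le divr_ge0// ltW.
Qed.

(** The distance budget: twice the cost per symbol, twice the size of the cells,
    and a remainder below [sigma] for the deviations and the unread times. *)
Lemma code_ball_avg_dist k K m (v : code_word {ffun 'I_n -> 'I_p} n k K) (G kappa sigma : R) x y :
  (0 < n)%N -> 0 <= e -> 0 < kappa -> 0 < sigma -> kappa <= sigma / 16 ->
  8 * D / sigma <= k.+1%:R -> 8 * D * (k.+1 * n)%:R / sigma <= m%:R ->
  (0 < m)%N -> (K * (k.+1 * n) <= m)%N -> (m <= K * (k.+1 * n) + k.+1 * n)%N -> 0 <= G ->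
  let tau := n%:R^-1 * ((K * (k.+1 * n))%:R * (G + kappa)) + K%:R * kappa in
  code_sum block_dist (fun i => block_label (iter i T x)) v <= tau ->
  code_sum block_dist (fun i => block_label (iter i T y)) v <= tau ->
  avg_dist T m x y < 2 * (n%:R^-1 * G) + 2 * e + sigma.
Proof.
move=> n0 e0 kappa0 sigma0 ks hk hm m0 KM mKM G0 tau hx hy.
have [nR0 mR0 kR0] : [/\ 0 < (n%:R : R), 0 < (m%:R : R) & 0 <= kappa].
  by rewrite !ltr0n ltW.
have KmR : K%:R * (k.+1 * n)%:R <= (m%:R : R) by rewrite -natrM ler_nat.
have n1 : n%:R^-1 <= 1 :> R by rewrite invf_le1// ler1n.
have KleR : K%:R <= (m%:R : R).
  by rewrite ler_nat; apply: leq_trans KM; rewrite leq_pmulr// muln_gt0.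
rewrite /avg_dist ltr_pdivrMl//; apply: le_lt_trans (orbit_dist_le v x y KM) _.
have h1 : tau <= m%:R * (n%:R^-1 * G) + m%:R * kappa + m%:R * kappa.
  rewrite /tau natrM; apply: lerD; last by rewrite ler_wpM2r.
  apply: (@le_trans _ _ (n%:R^-1 * (m%:R * (G + kappa)))).
    by rewrite ler_wpM2l ?invr_ge0// ler_wpM2r// addr_ge0.
  by rewrite mulrDr mulrDr mulrCA lerD2l ler_piMl ?mulr_ge0.
have h2 : (K * (k * n))%:R * (2 * e) <= m%:R * (2 * e).
  rewrite ler_wpM2r ?mulr_ge0// ler_nat; apply: leq_trans KM.
  by rewrite leq_mul2l mulSn leq_addl orbT.
have h3 : m%:R - (K * (k * n))%:R <= K%:R * n%:R + (k.+1 * n)%:R :> R.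
  rewrite lerBlDr -natrM -!natrD ler_nat addnC addnA -mulnDr.
  by rewrite [(k * n + n)%N]addnC -mulSn.
have h4 : K%:R * n%:R * D <= m%:R * sigma / 8.
  apply: (@le_trans _ _ (K%:R * n%:R * (k.+1%:R * sigma / 8))).
    rewrite ler_wpM2l ?mulr_ge0// ler_pdivlMr// mulrC.
    by rewrite -ler_pdivrMr.
  rewrite [leLHS](_ : _ = K%:R * (k.+1 * n)%:R * sigma / 8); last first.
    by rewrite natrM; ring.
  by rewrite ler_wpM2r// ler_wpM2r// ltW.
have h5 : (k.+1 * n)%:R * D <= m%:R * sigma / 8.
  rewrite ler_pdivlMr// -ler_pdivrMr//.
  by rewrite [X in X / _](_ : _ = 8 * D * (k.+1 * n)%:R)//; ring.
have h6 : (m%:R - (K * (k * n))%:R) * D <= m%:R * sigma / 8 + m%:R * sigma / 8.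
  apply: (@le_trans _ _ ((K%:R * n%:R + (k.+1 * n)%:R) * D)).
    by rewrite ler_wpM2r// ltW.
  by rewrite mulrDl lerD.
have h7 : m%:R * kappa <= m%:R * sigma / 16 by rewrite -mulrA ler_wpM2l.
have h8 : 0 < m%:R * sigma by exact: mulr_gt0.
have -> : m%:R * (2 * (n%:R^-1 * G) + 2 * e + sigma) =
    m%:R * sigma + (2 * (m%:R * (n%:R^-1 * G)) + m%:R * (2 * e)) by ring.
exact: distance_budget hy hx h1 h2 h6 h7 h8.
Qed.

(** By the ergodic theorem, applied to the conditional means of the likelihood
    ratio and of the cost, most points satisfy the hypotheses of
    [random_code_ball] with [F] and [G] close to [m * I] and [m * G]. *)
Lemma avg_entropy_le_channel (I G rho delta eta : R) : (0 < n)%N -> 0 <= e ->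
  (\int[mu]_x (\sum_u W (block_label x) u * log_ratio W q (block_label x) u)%:E = I%:E)%E ->
  (\int[mu]_x (\sum_u W (block_label x) u * block_dist (block_label x) u)%:E <= G%:E)%E ->
  2 * (n%:R^-1 * G) + 2 * e < rho -> 0 < delta -> 0 < eta ->
  (avg_entropy T mu rho delta <= (n%:R^-1 * I + eta)%:E)%E.
Proof.
move=> n0 e0 HI HG Grho delta0 eta0.
pose f x := \sum_u W (block_label x) u * log_ratio W q (block_label x) u.
pose h x := \sum_u W (block_label x) u * block_dist (block_label x) u.
have mf : measurable_fun setT f.
  exact: (measurable_fun_block_label (fun a => \sum_u W a u * log_ratio W q a u)).
have mh : measurable_fun setT h.
  exact: (measurable_fun_block_label (fun a => \sum_u W a u * block_dist a u)).
have f0 x : 0 <= f x by exact: divergence_ge0.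
have h0 x : 0 <= h x by apply: sumr_ge0 => u _; rewrite mulr_ge0// block_dist_ge0.
have I0 : 0 <= I.
  by rewrite -lee_fin -HI; apply: integral_ge0 => x _; rewrite lee_fin f0.
have G0 : 0 <= G.
  by rewrite -lee_fin (le_trans _ HG)//; apply: integral_ge0 => x _; rewrite lee_fin h0.
pose sigma := rho - (2 * (n%:R^-1 * G) + 2 * e).
have sigma0 : 0 < sigma by rewrite subr_gt0.
pose kappa := Num.min (sigma / 16) (eta / 8).
have kappa0 : 0 < kappa by rewrite lt_min !divr_gt0.
have ks : kappa <= sigma / 16 by rewrite ge_min lexx.
have ke : kappa <= eta / 8 by rewrite ge_min lexx orbT.
have [k Hk] := nat_ge (8 * D / sigma).
pose M := (k.+1 * n)%N.
have M0 : (0 < M)%N by rewrite muln_gt0.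
have [K0 HK0] := random_code_ball k W0 W1 q0 q1 Wq n0 kappa0 block_dist_ge0.
have delta4 : 0 < delta / 4 by rewrite divr_gt0.
have [m1 Hm1] : exists m1, forall m, (m1 <= m)%N ->
    (mu [set x | (m%:R * (I + kappa) < orbit_sum T f m x)%R] < (delta / 4)%:E)%E.
  by apply: ergodic_average_le => //; rewrite HI lte_fin ltrDl.
have [m2 Hm2] : exists m2, forall m, (m2 <= m)%N ->
    (mu [set x | (m%:R * (G + kappa) < orbit_sum T h m x)%R] < (delta / 4)%:E)%E.
  by apply: ergodic_average_le => //; rewrite (le_lt_trans HG)// lte_fin ltrDl.
pose C := `|ln (4 / delta)|.
have C0 : 0 <= C by exact: normr_ge0.
have [m3 Hm3] := nat_ge (2 * ln (2 * (C + 1)) / eta).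
have [m4 Hm4] := nat_ge (8 * D * M%:R / sigma).
pose m0 := ((K0 + m1 + m2).+1 * M + m3 + m4)%N.
apply: (@limn_esup_le _ _ _ m0) => m m0m.
have mM : ((K0 + m1 + m2).+1 * M <= m)%N.
  by apply: leq_trans m0m; rewrite /m0 -[X in (_ <= X)%N]addnA leq_addr.
have m3m : (m3 <= m)%N by apply: leq_trans m0m; rewrite /m0 [X in (_ <= X)%N]addnAC leq_addl.
have m4m : (m4 <= m)%N by apply: leq_trans m0m; rewrite /m0 leq_addl.
pose K := (m %/ M)%N.
have KM : (K * M <= m)%N by exact: leq_trunc_div.
have mKM : (m <= K * M + M)%N by rewrite {1}(divn_eq m M) leq_add2l ltnW// ltn_pmod.
have Kbig : ((K0 + m1 + m2).+1 <= K)%N by rewrite leq_divRL.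
have K0K : (K0 <= K)%N.
  by apply: leq_trans Kbig; rewrite -addnA -addnS leq_addr.
have m1K : (m1 <= K * M)%N.
  apply: (leq_trans _ (leq_pmulr K M0)); apply: leq_trans Kbig.
  by rewrite -addnS addnAC leq_addl.
have m2K : (m2 <= K * M)%N.
  apply: (leq_trans _ (leq_pmulr K M0)); apply: leq_trans Kbig.
  by rewrite -addSn leq_addl.
have mgt0 : (0 < m)%N by apply: leq_trans mM; rewrite muln_gt0 M0.
pose F := (K * M)%:R * (I + kappa).
pose Gm := (K * M)%:R * (G + kappa).
pose E1 := [set x | (F < orbit_sum T f (K * M) x)%R].
pose E2 := [set x | (Gm < orbit_sum T h (K * M) x)%R].
have mE1 : measurable E1 by exact: measurable_orbit_sum_gt.
have mE2 : measurable E2 by exact: measurable_orbit_sum_gt.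
have mE : measurable (~` (E1 `|` E2)) by apply: measurableC; exact: measurableU.
have muE : (mu (~` ~` (E1 `|` E2)) <= (delta / 2)%:E)%E.
  rewrite setCK (le_trans (measureU2 mu mE1 mE2))//.
  have -> : (delta / 2)%:E = ((delta / 4)%:E + (delta / 4)%:E)%E.
    by rewrite -EFinD; congr (_%:E); field.
  by apply: leeD; apply: ltW; [exact: Hm1|exact: Hm2].
pose V : finType := code_word {ffun 'I_n -> 'I_p} n k K.
pose tau := n%:R^-1 * Gm + K%:R * kappa.
pose B (v : V) := [set x | code_sum block_dist (fun i => block_label (iter i T x)) v <= tau].
have mB v : measurable (B v) by exact: measurable_code_ball.
have cw0 (v : V) : 0 <= code_weight q v by exact: code_weight_ge0.
have cw1 : \sum_(v : V) code_weight q v <= 1 by rewrite (sum_code_weight k q1 K n0).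
pose c := 2^-1 * expR (- (n%:R^-1 * F + K%:R * kappa)).
have c0 : 0 < c by rewrite mulr_gt0 ?expR_gt0.
have Ec x : (~` (E1 `|` E2)) x -> c <= \sum_(v : V | `[< B v x >]) code_weight q v.
  move=> /not_orP[/negP + /negP]; rewrite -!leNgt => nG1 nG2.
  have := HK0 K K0K (fun i => block_label (iter i T x)) F Gm nG1 nG2.
  move=> /le_trans; apply; rewrite le_eqVlt; apply/orP; left; apply/eqP.
  by apply: eq_bigl => v; apply/idP/asboolP.
have Bdist (v : V) x y : B v x -> B v y -> avg_dist T m x y < rho.
  have -> : rho = 2 * (n%:R^-1 * G) + 2 * e + sigma by rewrite addrC subrK.
  by apply: (code_ball_avg_dist (K := K)) => //; [exact: Hk|exact: Hm4].
have cover := avg_cover_number_le_code cw0 cw1 mB mE c0 delta0 muE Ec Bdist.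
have m0R : 0 < (m%:R : R) by rewrite ltr0n.
apply: (@le_trans _ _ ((m%:R^-1)%:E * (ln (C / c + 1))%:E)%E).
  have cover0 : (0 <= avg_cover_number T mu m rho delta)%E.
    by apply: le_ereal_inf_tmp => _ [l -> _]; rewrite lee_fin.
  have C1 : 0 < C / c + 1 by rewrite ltr_wpDl// divr_ge0// ltW.
  rewrite lee_pmul2l ?lte_fin ?invr_gt0// -lne_EFin//.
  by rewrite lee_lne ?in_itv/= ?leey ?andbT// lee_fin ltW.
rewrite -EFinM lee_fin ler_pdivrMl// [leRHS]mulrC.
apply: (@code_rate_budget R C n m (K * M) K I kappa eta) => //; last first.
- by rewrite -ler_pdivrMr// Hm3.
- exact: leq_pmulr.
Qed.

End lower_bound_channel.

(** * From a coupling to a channel *)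

Section channel_of_coupling.
Context (R : realType) (A U : finType) (p : A -> U -> R).
Context (p0 : forall a u, 0 <= p a u) (p1 : \sum_a \sum_u p a u = 1).

Definition output_law u := \sum_a p a u.
(** The conditional law of the second coordinate given the first. On inputs of
    probability 0 the output law keeps every row a probability that is absolutely
    continuous with respect to the output law. *)
Definition channel a u :=
  if \sum_u p a u == 0 then output_law u else p a u / \sum_u p a u.

Lemma output_law_ge0 u : 0 <= output_law u.
Proof. exact: sumr_ge0. Qed.

Lemma sum_output_law : \sum_u output_law u = 1.
Proof. by rewrite exchange_big. Qed.

Lemma channel_ge0 a u : 0 <= channel a u.
Proof.
rewrite /channel; case: ifP => _; first exact: output_law_ge0.
by rewrite divr_ge0// sumr_ge0.
Qed.

Lemma sum_channel a : \sum_u channel a u = 1.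
Proof.
rewrite /channel; case: eqP => [_|/eqP nz]; first exact: sum_output_law.
by rewrite -mulr_suml mulfV.
Qed.

Lemma coupling_le_output a u : p a u <= output_law u.
Proof. by rewrite /output_law (bigD1 a)//= lerDl sumr_ge0. Qed.

Lemma channel_gt0 a u : 0 < channel a u -> 0 < output_law u.
Proof.
rewrite /channel; case: ifP => // nz H.
have s0 : 0 <= \sum_u p a u by exact: sumr_ge0.
apply: lt_le_trans (coupling_le_output a u).
rewrite lt_neqAle p0 andbT; apply/eqP => pz; move: H.
by rewrite -pz mul0r ltxx.
Qed.

Lemma channelE a u : (\sum_u p a u) * channel a u = p a u.
Proof.
rewrite /channel; case: eqP => [z|/eqP nz]; last by rewrite mulrCA mulfV ?mulr1.
rewrite z mul0r; apply/esym/eqP.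
by move/eqP: z; rewrite psumr_eq0// => /allP/(_ u); apply; rewrite mem_index_enum.
Qed.

Lemma joint_info_channel :
  \sum_a (\sum_u p a u) * \sum_u channel a u * log_ratio channel output_law a u =
  joint_info p.
Proof.
apply: eq_bigr => a _; rewrite mulr_sumr; apply: eq_bigr => u _.
rewrite mulrA channelE; have := p0 a u.
rewrite le_eqVlt => /predU1P[<-|pos]; first by rewrite !mul0r.
congr (_ * _).
have qpos : 0 < output_law u by exact: lt_le_trans (coupling_le_output a u).
have spos : 0 < \sum_u p a u.
  by apply: (lt_le_trans pos); rewrite (bigD1 u)//= lerDl sumr_ge0.
by rewrite /log_ratio /channel (gt_eqF spos) !ln_div ?posrE// divr_gt0.
Qed.

End channel_of_coupling.

Section integral_of_labels.
Context d (Omega : measurableType d) (R : realType) (P : probability Omega R).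

Lemma integral_label (I : finType) (L : Omega -> I) (f : I -> R) :
  measurable_label L -> (forall i, 0 <= f i) ->
  (\int[P]_w (f (L w))%:E = (\sum_i law P L i * f i)%:E)%E.
Proof.
move=> mL f0.
have -> : (fun w => (f (L w))%:E) =
    (fun w => \sum_i (f i * \1_(L @^-1` [set i]) w)%:E)%E.
  apply/funext => w; rewrite sumEFin (bigD1 (L w))//= big1 ?addr0.
    by rewrite indicE mem_set ?mulr1.
  by move=> i /eqP iL; rewrite indicE memNset ?mulr0// => /esym.
rewrite ge0_integral_sum//=; last 2 first.
- move=> i; apply/measurable_EFinP/measurable_funM => //.
- by move=> i w _; rewrite lee_fin mulr_ge0.
rewrite -sumEFin; apply: eq_bigr => i _.
have mLi : measurable (L @^-1` [set i]) by exact: mL.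
under eq_integral do rewrite EFinM.
rewrite ge0_integralZl_EFin//=; last exact/measurable_EFinP/measurable_indic.
rewrite integral_indic// setIT muleC EFinM; congr (_ * _)%E.
by rewrite fineK// fin_num_measure.
Qed.

End integral_of_labels.

Lemma measurable_label_mfun d (S : measurableType d) (I : finType) (L : S -> I) :
  measurable_label L ->
  exists2 a : {mfun S >-> nat}, (a : S -> nat) = pickle \o L & finite_set (range a).
Proof.
move=> mL.
have mp : measurable_fun setT (pickle \o L) by exact: measurable_fun_label.
pose a : {mfun S >-> nat} := HB.pack (pickle \o L) (isMeasurableFun.Build _ _ _ _ _ mp).
exists a => //.
apply: (@sub_finite_set _ _ (pickle @` [set: I])); last exact: finite_image.
by move=> _ [x _ <-]; exists (L x).
Qed.

Section lower_bound_coupling.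
Context d (R : realType) (X : measurableMetricType d R) (T : X -> X)
  (mu : probability X R).
Context (x0 : X) (X_borel : @measurable d X = <<s @open X >>)
  (X_compact : compact [set: X]) (T_cont : continuous T)
  (mu_inv : invariant_measure T mu) (mu_erg : ergodic_measure T mu).
Context (D : R) (mD : forall x y : X, mdist x y <= D) (D0 : 0 < D).

(** Replacing both variables of the coupling by the cells that they visit does not
    increase the information, which is a supremum over such discretizations, and
    changes the distortion by at most [2 * e]. The finite joint law obtained is
    factored as a channel. *)
Lemma avg_entropy_le_coupling (n : nat) d' (Omega : measurableType d')
    (P : probability Omega R) (x : {RV P >-> X}) (y : {RV P >-> n.-tuple X})
    (eps rho delta : R) :
  (0 < n)%N -> 0 < eps -> 2 * eps < rho -> 0 < delta ->
  rate_condition T mu eps x y ->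
  (avg_entropy T mu rho delta <= (n%:R^-1)%:E * mutual_info P x y)%E.
Proof.
move=> n0 eps0 rho_gt delta0 [law_x dist_xy].
have nR0 : 0 < (n%:R : R) by rewrite ltr0n.
pose e := (rho - 2 * eps) / 12.
have e0 : 0 < e by rewrite divr_gt0// subr_gt0.
have [p [cc [g [mg gE]]]] := compact_labels X_borel X_compact e0.
have mT : measurable_fun setT T by exact: continuous_borel.
have mbl : measurable_label (block_label T g n) by exact: measurable_block_label.
pose tl (t : n.-tuple X) := [ffun k : 'I_n => g (tnth t k)].
have mtl : measurable_label tl.
  apply: measurable_label_ffun => k.
  exact: (measurable_label_precomp (measurable_tnth k) mg).
pose Lx w := block_label T g n (x w).
pose Ly w := tl (y w).
have mx : measurable_fun setT (x : Omega -> X) by exact: measurable_funPT.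
have my : measurable_fun setT (y : Omega -> n.-tuple X) by exact: measurable_funPT.
have mLx : measurable_label Lx by exact: measurable_label_precomp mx mbl.
have mLy : measurable_label Ly by exact: measurable_label_precomp my mtl.
pose Lxy w := (Lx w, Ly w).
have mLxy : measurable_label Lxy.
  apply: measurable_label_fiber => -[i j].
  rewrite (_ : Lxy @^-1` _ = Lx @^-1` [set i] `&` Ly @^-1` [set j]).
    by apply: measurableI; [exact: mLx|exact: mLy].
  by apply/seteqP; split => w /= => [[<- <-]|[<- <-]].
pose j a u := law P Lxy (a, u).
have j0 a u : 0 <= j a u by exact: law_ge0.
have j1 : \sum_a \sum_u j a u = 1.
  by rewrite pair_big/= -(law_sum1 P mLxy); apply: eq_bigr => -[].
have jx a : law mu (block_label T g n) a = \sum_u j a u.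
  rewrite -(law_pair_l P a mLxy) /law -law_x//; exact: mbl.
pose W := channel j; pose q := output_law j.
have Hf : (\int[mu]_z (\sum_u W (block_label T g n z) u *
    log_ratio W q (block_label T g n z) u)%:E = (joint_info j)%:E)%E.
  rewrite (@integral_label _ X R mu _ _ (fun a => \sum_u W a u * log_ratio W q a u))//.
    rewrite -(joint_info_channel j0); congr (_%:E); apply: eq_bigr => a _.
    by rewrite jx.
  move=> a; apply: divergence_ge0.
  - exact: channel_ge0.
  - exact: sum_channel.
  - exact: output_law_ge0.
  - exact: sum_output_law.
  - exact: channel_gt0.
have Hh : (\int[mu]_z (\sum_u W (block_label T g n z) u *
    block_dist cc (block_label T g n z) u)%:E <= (n%:R * (eps + 2 * e))%:E)%E.
  rewrite (@integral_label _ X R mu _ _ (fun a => \sum_u W a u * block_dist cc a u))//; last first.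
    by move=> a; apply: sumr_ge0 => u _; rewrite mulr_ge0 ?channel_ge0 ?block_dist_ge0.
  pose c (au : {ffun 'I_n -> 'I_p} * {ffun 'I_n -> 'I_p}) := block_dist cc au.1 au.2.
  have -> : \sum_a law mu (block_label T g n) a * (\sum_u W a u * block_dist cc a u) =
      \sum_au law P Lxy au * c au.
    rewrite [RHS](eq_bigr (fun au => law P Lxy (au.1, au.2) * c (au.1, au.2))); last by case.
    rewrite -(pair_bigA _ (fun a u => law P Lxy (a, u) * c (a, u)))/=.
    apply: eq_bigr => a _; rewrite jx mulr_sumr; apply: eq_bigr => u _.
    by rewrite mulrA channelE.
  rewrite -(integral_label P (L := Lxy) (f := c) mLxy); last by move=> au; exact: block_dist_ge0.
  pose r w := n%:R^-1 * \sum_(k < n) mdist (iter k T (x w)) (tnth (y w) k).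
  have mr : measurable_fun setT r.
    apply: measurable_funM => //; apply: measurable_sum => k.
    apply: (measurable_fun_mdist X_borel X_compact).
      exact: (measurableT_comp (measurable_iter mT k) mx).
    exact: (measurableT_comp (measurable_tnth k) my).
  have r0 w : 0 <= r w.
    by rewrite mulr_ge0 ?invr_ge0//; apply: sumr_ge0 => k _; exact: mdist_ge0.
  apply: (@le_trans _ _ (\int[P]_w (n%:R%:E * ((r w)%:E + (2 * e)%:E)))%E).
    apply: ge0_le_integral => //=.
    - by move=> w _; rewrite lee_fin; exact: block_dist_ge0.
    - by apply/measurable_EFinP; exact: measurable_fun_label.
    - apply: (measurable_funeM n%:R%:E); apply: emeasurable_funD => //.
      exact/measurable_EFinP.
    - move=> w _; rewrite -EFinD -EFinM lee_fin mulrDr mulVKf ?gt_eqF//.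
      rewrite mulr_natl -[n in _ *+ n]card_ord -sumr_const -big_split/=.
      rewrite /c /block_dist; apply: ler_sum => k _; rewrite !ffunE.
      set u := iter _ _ _; set v := tnth _ _.
      have := gE u; have := gE v.
      have := metric_triangle (cc (g u)) u (cc (g v)); have := metric_triangle u v (cc (g v)).
      rewrite (metric_sym (cc (g u)) u); lra.
  rewrite ge0_integralZl_EFin//=; last 2 first.
  - by move=> w _; rewrite -EFinD lee_fin addr_ge0// mulr_ge0// ltW.
  - by apply: emeasurable_funD => //; exact/measurable_EFinP.
  rewrite ge0_integralD//=; last 3 first.
  - by move=> w _; rewrite lee_fin.
  - exact/measurable_EFinP.
  - by move=> w _; rewrite lee_fin mulr_ge0// ltW.
  rewrite integral_cst//= (@probability_setT _ _ _ P) mule1.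
  rewrite [X in (_ <= X)%E]EFinM lee_pmul2l ?lte_fin// EFinD leeD2r//.
  by move: dist_xy; rewrite unlock.
have le_e : 2 * (n%:R^-1 * (n%:R * (eps + 2 * e))) + 2 * e < rho.
  by rewrite mulKf ?gt_eqF// /e; lra.
have I_le : ((joint_info j)%:E <= mutual_info P x y)%E.
  have [a aE fa] := measurable_label_mfun mbl.
  have [b bE fb] := measurable_label_mfun mtl.
  apply: ereal_sup_ubound; exists a, b; split => //; rewrite aE bE.
  have pinj (I : countType) : injective (@pickle I) by exact: pcan_inj (@pickleK I).
  by congr (_%:E); apply/esym; apply: (@finite_mutual_info_law _ _ R P _ _ _ _ Lx Ly).
apply: (@le_trans _ _ ((n%:R^-1)%:E * (joint_info j)%:E)%E); last first.
  by rewrite lee_pmul2l ?lte_fin ?invr_gt0.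
rewrite -EFinM; apply/lee_addgt0Pr => eta eta0; rewrite -EFinD.
apply: (avg_entropy_le_channel x0 X_borel T_cont mu_inv mu_erg mD D0 mg gE
  (channel_ge0 j0) (sum_channel j1) (output_law_ge0 j0) (sum_output_law j1)
  (channel_gt0 j0) n0 (ltW e0) Hf Hh le_e delta0 eta0).
Qed.

End lower_bound_coupling.

(** * The two inequalities *)

Theorem theorem7 (d : measure_display) (R : realType)
    (X : measurableMetricType d R) (D : R) (T : X -> X)
    (mu : probability X R) (L eps : R)
    (X_borel : @measurable d X = <<s @open X >>)
    (X_compact : compact [set: X])
    (X_diam : diameter X = D) (D_gt0 : 0 < D)
    (T_cont : continuous T)
    (mu_inv : invariant_measure T mu) (mu_erg : ergodic_measure T mu)
    (L_gt1 : 1 < L) (eps_gt0 : 0 < eps) (eps_lt : eps < 2 * D) :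
  (avg_entropy T mu (4 * L * eps) (1 / L) <= rate_distortion T mu eps)%E /\
  (rate_distortion T mu eps <= avg_entropy T mu eps (eps / (2 * D)))%E.
Proof.
have [x0 _] : exists x0 : X, True.
  apply: contrapT => /forallNP noX.
  have := @probability_setT _ _ _ mu.
  rewrite (_ : [set: X] = set0) ?measure0; last by rewrite -subset0 => x; have := noX x.
  by move/eqP; rewrite eq_sym onee_eq0.
have mD (x y : X) : mdist x y <= D by rewrite -X_diam; exact: mdist_le_diameter.
split.
  apply: le_ereal_inf_tmp => r [n [d' [S [P [x [y Hxy]]]]]].
  have [n0 xy ->] := Hxy.
  apply: (avg_entropy_le_coupling x0 X_borel X_compact T_cont mu_inv mu_erg mD D_gt0
    n0 eps_gt0 _ _ xy).
    by rewrite ltr_pM2r//; lra.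
  by rewrite divr_gt0//; lra.
apply: (rate_distortion_le_avg_entropy x0 X_borel X_compact T_cont mu_inv mu_erg mD)=> //.
by rewrite ltr_pdivrMr ?mul1r// mulr_gt0.
Qed.
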